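(* Let $a,b$ be relatively prime positive integers such that the zeta map is a bijection on $\mathfrak{D}_{c,d}$ for all relatively prime positive integers $c\le a$, $d\le b$. Let $0\le k<a$ and let $Q_k\in\mathfrak{D}_{a,b}$ be a $k$th valley Dyck path. Then the bounded partition of $\chi(Q_k)$, drawn rotated by $180^\circ$ below the main diagonal of the $a\times b$ grid, is the (disjoint) union of $\hat V_1,\dots,\hat V_k$.
   Context: An $(a,b)$-Dyck path is a lattice path from $(0,0)$ to $(b,a)$ with unit north steps and unit east steps, all of whose lattice points $(x,y)$ satisfy $ax\le by$; it is drawn in the grid with $a$ rows and $b$ columns. $\mathfrak{D}_{a,b}$ is the set of all of them. The level of the lattice point $(x,y)$ is $by-ax$. The main diagonal is the segment from $(0,0)$ to $(b,a)$. A valley of a path is a lattice point at which an east step is followed by a north step. $k$th valley Dyck path: for $k<a$, the $(a,b)$-Dyck path $Q_k$ whose valleys are exactly at the lattice points of levels $1,2,\dots,k$ (together with the endpoint level $0$). Rectangles: for $0<l<a$ let $p$ be the lattice point of level $l$ in the $a\times b$ grid. $U_l$ is the rectangle composed of the boxes of the grid northwest of $p$ and $\tilde U_l$ the rectangle composed of the boxes southeast of $p$. $\hat U_l$ is the set of boxes of $\tilde U_l$ lying below the main diagonal (equivalently $\tilde U_l$ with the box in its upper left corner removed). Set $\hat V_l=\hat U_l\setminus\bigcup_{i=1}^{l-1}\hat U_i$. The partition bounded by a path is the partition whose Young diagram (English notation) is the set of boxes of the grid above (northwest of) the path. Rotating the grid by $180^\circ$ about its centre, this becomes a set of boxes in the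 southeast corner of the grid, lying below the main diagonal; this is what is meant by drawing the bounded partition rotated by $180^\circ$. Hooks and cores: the unit box with southeast corner $(x,y)$ has hook filling $by-ax$. The positive hooks of $P$ are the positive hook fillings of the boxes of the grid lying below (southeast of) $P$. $\mathfrak{c}(P)$ is the partition whose set of first-column hook lengths is the set of positive hooks of $P$ (it has no hook length equal to $a$ or $b$). For a partition $\kappa$ and a positive integer $m$: for each residue modulo $m$ occurring among the first-column hook lengths of $\kappa$ take the largest such hook length; the rows with these first-column hook lengths are the $m$-rows of $\kappa$; the $m$-boundary is the set of boxes with hook length less than $m$. Zeta: $\lambda(P)=(\lambda_1\ge\dots\ge\lambda_a)$ has as parts the numbers of $b$-boundary boxes in the $a$-rows of $\mathfrak{c}(P)$ (padded with zeros). $\zeta(P)$ is the $(a,b)$-Dyck path bounding $\lambda(P)$. Conjugation: $P^c$ is obtained by applying cyclic shifts to the step sequence of $P$ until a path lying strictly below the diagonal (except at its two endpoints) is obtained (there is exactly one such cyclic shift), and rotating this path by $180^\circ$. When $\zeta$ is a bijection, the conjugate-area map is $\chi(Q)=\zeta\big((\zeta^{-1}(Q))^c\big)$. *)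

(* Defs.v *)
From mathcomp Require Import all_boot all_order all_algebra.

Set Implicit Arguments.
Unset Strict Implicit.
Unset Printing Implicit Defensive.

Import Order.TTheory GRing.Theory Num.Theory.

(* A lattice path is its word of steps: [true] is a north step, [false] an   *)
(* east step. A point (x, y) is stored as a pair, x first. A box of the grid *)
(* with a rows and b columns is named by its southwest corner.               *)

Definition point (w : seq bool) (i : nat) : nat * nat :=
  (count_mem false (take i w), count_mem true (take i w)).

Definition level (a b : nat) (p : nat * nat) : int :=
  ((b * p.2)%:Z - (a * p.1)%:Z)%R.

Definition lpath (a b : nat) := (a + b).-tuple bool.

Definition dyck (a b : nat) : {set lpath a b} :=
  [set P : lpath a b | (count_mem true P == a)
     && all (fun i => (0 <= level a b (point P i))%R) (iota 0 (a + b).+1)].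

(* A valley is an interior point of the path, so the two endpoints, of       *)
(* level 0, are never valleys here.                                          *)
Definition valley (w : seq bool) (p : nat * nat) : bool :=
  has (fun i => [&& ~~ nth true w i, nth false w i.+1 & p == point w i.+1])
      (iota 0 (size w)).

Definition kth_valley_path (a b k : nat) (Q : lpath a b) : Prop :=
  Q \in dyck a b /\
  forall x y, x <= b -> y <= a ->
    valley Q (x, y) = (1 <= level a b (x, y) <= k%:Z)%R.

(* A box lies northwest of the path when some point of the path is weakly    *)
(* southeast of the southeast corner (x.+1, y) of the box.                   *)
Definition above (w : seq bool) (x y : nat) : bool :=
  has (fun i => (x < (point w i).1) && ((point w i).2 <= y))
      (iota 0 (size w).+1).

(* Row r of the English diagram is the row y = a - r.+1 of the grid.         *)
Definition bounded_partition (a b : nat) (w : seq bool) : seq nat :=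
  [seq count (fun x => above w x (a - r.+1)) (iota 0 b) | r <- iota 0 a].

Definition box (a b : nat) := ('I_b * 'I_a)%type.

(* The diagram of mu in the northwest corner of the grid, rotated by 180     *)
(* degrees: row r and column c of mu become y = r and x = b - c.+1.          *)
Definition rotated_diagram (a b : nat) (mu : seq nat) : {set box a b} :=
  [set c : box a b | rev_ord c.1 < nth 0 mu c.2].

(* The path with bounded partition mu: the north step in row y of the grid   *)
(* is preceded by y north steps and by mu_(a - y.+1) east steps.             *)
Definition bounding_path (a b : nat) (mu : seq nat) : lpath a b :=
  [tuple (val i \in [seq y + nth 0 mu (a - y.+1) | y <- iota 0 a])
    | i < a + b].

Definition positive_hooks (a b : nat) (w : seq bool) : seq nat :=
  sort geq
    [seq absz (level a b (c.1.+1, c.2)) |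
      c <- [seq (x, y) | x <- iota 0 b, y <- iota 0 a] &
      ~~ above w c.1 c.2 && (0 < level a b (c.1.+1, c.2))%R].

(* Partitions are weakly decreasing sequences of nats.                       *)
Definition hook (kappa : seq nat) (i j : nat) : nat :=
  (nth 0 kappa i - j.+1) + count (fun r => j < r) (drop i.+1 kappa) + 1.

Definition first_column (kappa : seq nat) : seq nat :=
  [seq hook kappa i 0 | i <- iota 0 (size kappa)].

(* The partition whose first-column hook lengths are h, for h strictly       *)
(* decreasing and positive: see [first_columnK].                             *)
Definition partition_of_first_column (h : seq nat) : seq nat :=
  [seq nth 0 h i - (size h - i.+1) | i <- iota 0 (size h)].

Definition core (a b : nat) (w : seq bool) : seq nat :=
  partition_of_first_column (positive_hooks a b w).

Definition m_rows (m : nat) (kappa : seq nat) : seq nat :=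
  [seq i <- iota 0 (size kappa) |
    all (fun r => (hook kappa r 0 == hook kappa i 0 %[mod m])
                  ==> (hook kappa r 0 <= hook kappa i 0))
        (iota 0 (size kappa))].

Definition m_boundary_in_row (m : nat) (kappa : seq nat) (i : nat) : nat :=
  count (fun j => hook kappa i j < m) (iota 0 (nth 0 kappa i)).

Definition lambda (a b : nat) (w : seq bool) : seq nat :=
  let kappa := core a b w in
  let parts := sort geq
    [seq m_boundary_in_row b kappa i | i <- m_rows a kappa] in
  parts ++ nseq (a - size parts) 0.

Definition zeta (a b : nat) (P : lpath a b) : lpath a b :=
  bounding_path a b (lambda a b P).

Definition zeta_bijective (a b : nat) : Prop :=
  [/\ {in dyck a b, forall P, zeta P \in dyck a b},
      {in dyck a b &, injective (@zeta a b)}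
    & {in dyck a b, forall Q, exists2 P, P \in dyck a b & zeta P = Q}].

Definition strictly_below (a b : nat) (w : seq bool) : bool :=
  all (fun i => (level a b (point w i) < 0)%R) (iota 1 (a + b).-1).

(* Rotating a path by 180 degrees reverses its word.                         *)
Definition conjugate (a b : nat) (P : lpath a b) : lpath a b :=
  let n := find (fun i => strictly_below a b (rot i P)) (iota 0 (a + b)) in
  [tuple of rev (rot n P)].

(* The inverse on [dyck a b]; the default is irrelevant when zeta is         *)
(* bijective there.                                                          *)
Definition zeta_inv (a b : nat) (Q : lpath a b) : lpath a b :=
  odflt Q [pick P in dyck a b | zeta P == Q].

Definition chi (a b : nat) (Q : lpath a b) : lpath a b :=
  zeta (conjugate (zeta_inv Q)).

Definition Utilde (a b l : nat) : {set box a b} :=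
  [set c : box a b | [exists p : 'I_b.+1 * 'I_a.+1,
     [&& level a b (val p.1, val p.2) == Posz l, p.1 <= c.1 & c.2 < p.2]]].

(* A box lies below the main diagonal when its northwest corner does.        *)
Definition Uhat (a b l : nat) : {set box a b} :=
  [set c in Utilde a b l | (level a b (val c.1, (val c.2).+1) <= 0)%R].

Definition Vhat (a b l : nat) : {set box a b} :=
  Uhat a b l :\: \bigcup_(1 <= i < l) Uhat a b i.

Lemma first_columnK (h : seq nat) :
  sorted gtn h -> 0 \notin h -> first_column (partition_of_first_column h) = h.
Proof.
move=> hs h0; set m := size h.
have sz : size (partition_of_first_column h) = m.
  by rewrite size_map size_iota.
have lb : forall n i, i < m -> m - i = n -> n <= nth 0 h i.
  elim=> [//|n IH] i im ein.
  have hi : 0 < nth 0 h i.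
    by rewrite lt0n; apply: contraNneq h0 => <-; apply: mem_nth.
  case: (ltnP i.+1 m) => im1.
    have := IH i.+1 im1; rewrite subnS ein => /(_ erefl) /= hn.
    apply: leq_ltn_trans hn _.
    by apply: (sorted_ltn_nth (rev_trans ltn_trans) 0 hs); rewrite ?inE.
  have e1 : i.+1 = m by apply/eqP; rewrite eqn_leq im im1.
  by move: ein; rewrite -e1 subSnn => -[<-].
have nthp : forall i, i < m ->
    nth 0 (partition_of_first_column h) i = nth 0 h i - (m - i.+1).
  by move=> i im; rewrite (nth_map 0) ?size_iota // nth_iota.
apply: (@eq_from_nth _ 0); first by rewrite size_map size_iota sz.
move=> i; rewrite size_map size_iota sz => im.
rewrite (nth_map 0) ?size_iota ?sz // nth_iota // add0n /hook nthp //.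
have -> : count (fun r => 0 < r) (drop i.+1 (partition_of_first_column h))
          = m - i.+1.
  rewrite -sz -size_drop; apply/eqP; rewrite -all_count.
  apply/(all_nthP 0) => j; rewrite size_drop sz => jm.
  have jm' : i.+1 + j < m by rewrite -ltn_subRL.
  rewrite nth_drop nthp // subn_gt0 (leq_trans _ (lb _ _ jm' erefl)) //.
  by rewrite subnS prednK ?subn_gt0.
rewrite -addnA -subnDA addn1 subnK // subnSK //.
exact: lb.
Qed.

Lemma bounding_pathK (a b : nat) (mu : seq nat) :
  size mu = a -> sorted geq mu -> all (fun r => r <= b) mu ->
  bounded_partition a b (bounding_path a b mu) = mu.
Proof.
move=> smu mus mub; pose f y := y + nth 0 mu (a - y.+1).
set w : seq bool := bounding_path a b mu.
have sw : size w = a + b by rewrite size_tuple.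
have mule y : nth 0 mu y <= b.
  by case: (ltnP y (size mu)) => [/(all_nthP 0 mub)|/(nth_default 0) ->].
have flt y : y < a -> f y < a + b.
  by move=> ya; rewrite /f -addSn leq_add.
have fmono y z : y < z -> z < a -> f y < f z.
  move=> yz za; rewrite /f -addSn leq_add //.
  apply: (sorted_leq_nth (rev_trans leq_trans) leqnn 0 mus);
    rewrite ?inE ?smu ?ltn_subrL ?(leq_ltn_trans _ za) //.
  by apply: leq_sub2l; apply: ltnW.
have fmonoE y z : y < a -> z < a -> (f y < f z) = (y < z).
  move=> ya za; case: (ltngtP y z) => [yz|zy|->]; last by rewrite ltnn.
    by rewrite fmono.
  by apply/negbTE; rewrite -leqNgt ltnW // fmono.
have wE : w = [seq i \in [seq f y | y <- iota 0 a] | i <- iota 0 (a + b)].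
  apply: (@eq_from_nth _ false); first by rewrite size_map size_iota.
  move=> i; rewrite sw => iab.
  rewrite (nth_map 0) ?size_iota // nth_iota //.
  by rewrite -[i]/(val (Ordinal iab)) -tnth_nth tnth_mktuple.
have Ncount i : i <= a + b ->
    (point w i).2 = count (fun y => f y < i) (iota 0 a).
  move=> iab; rewrite /point /= wE -map_take take_iota (minn_idPl iab).
  rewrite count_map -(count_map f (fun z => z < i)) -size_filter -[RHS]size_filter.
  apply: perm_size; apply: uniq_perm; rewrite ?filter_uniq ?iota_uniq //.
    rewrite map_inj_in_uniq ?iota_uniq // => y z.
    rewrite !mem_iota !add0n /= => ya za fyz.
    case: (ltngtP y z) => [yz|zy|//].
      by have := fmono _ _ yz za; rewrite fyz ltnn.
    by have := fmono _ _ zy ya; rewrite fyz ltnn.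
  by move=> z; rewrite !mem_filter mem_iota /= add0n eqb_id andbC.
have sum i : i <= a + b -> (point w i).1 + (point w i).2 = i.
  move=> iab; rewrite /point /= addnC -[RHS](_ : size (take i w) = i).
    rewrite -(count_predC (pred1 true)); congr (_ + _).
    by apply: eq_count => -[].
  by rewrite size_takel // sw.
have Nf y : y < a -> (point w (f y)).2 = y.
  move=> ya; rewrite Ncount; last exact: ltnW (flt y ya).
  rewrite (eq_in_count (a2 := fun z => z < y)); last first.
    by move=> z; rewrite mem_iota add0n /= => za; rewrite fmonoE.
  have -> : iota 0 a = iota 0 y ++ iota y (a - y).
    by rewrite -{2}[y]add0n -iotaD subnKC // ltnW.
  rewrite count_cat [X in X + _](_ : _ = y); last first.
    rewrite -[RHS](size_iota 0 y); apply/eqP; rewrite -all_count.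
    by apply/allP => z; rewrite mem_iota add0n.
  rewrite [X in _ + X](_ : _ = 0) ?addn0 //.
  apply/eqP; rewrite -leqn0 leqNgt -has_count -all_predC.
  by apply/allP => z; rewrite mem_iota /= -leqNgt => /andP[].
have Xf y : y < a -> (point w (f y)).1 = nth 0 mu (a - y.+1).
  move=> ya; apply/(@addnI y); rewrite -/(f y) -[RHS](sum (f y)).
    by rewrite Nf // addnC.
  exact: ltnW (flt y ya).
have Xmono i j : i <= j -> (point w i).1 <= (point w j).1.
  move=> ij; rewrite /point /= -[take i w](_ : take i (take j w) = _).
    by rewrite -{2}(cat_take_drop i (take j w)) count_cat leq_addr.
  by rewrite take_takel.
have aboveE x y : y < a -> above w x y = (x < nth 0 mu (a - y.+1)).
  move=> ya; apply/hasP/idP => [[i]|xy].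
    rewrite mem_iota add0n leq0n ltnS sw => iab /andP[xi iy].
    rewrite -Xf //; apply: leq_trans xi (Xmono _ _ _).
    case: (leqP i (f y)) => // fi; move: iy; rewrite Ncount // leqNgt.
    have -> : iota 0 a = iota 0 y.+1 ++ iota y.+1 (a - y.+1).
      by rewrite -{2}[y.+1]add0n -iotaD subnKC.
    rewrite count_cat => /negP[]; apply: leq_trans (leq_addr _ _).
    rewrite -[leqLHS](size_iota 0) leq_eqVlt eq_sym -all_count.
    apply/orP; left; apply/allP => z; rewrite mem_iota add0n ltnS /= => zy.
    apply: leq_ltn_trans fi; move: zy; rewrite leq_eqVlt => /predU1P[->//|zy].
    exact: ltnW (fmono _ _ zy ya).
  exists (f y); last by rewrite Xf // Nf // xy leqnn.
  by rewrite mem_iota add0n leq0n ltnS sw ltnW ?flt.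
apply: (@eq_from_nth _ 0); first by rewrite size_map size_iota smu.
move=> r; rewrite size_map size_iota => ra.
rewrite (nth_map 0) ?size_iota // nth_iota // add0n.
have ar : a - r.+1 < a by rewrite ltn_subrL (leq_ltn_trans _ ra).
rewrite (eq_count (a2 := fun x => x < nth 0 mu r)); last first.
  by move=> x; rewrite aboveE // subnSK // subKn // ltnW.
have -> : iota 0 b = iota 0 (nth 0 mu r) ++ iota (nth 0 mu r) (b - nth 0 mu r).
  by rewrite -{2}[nth 0 mu r]add0n -iotaD subnKC.
rewrite count_cat [X in X + _](_ : _ = nth 0 mu r); last first.
  rewrite -[RHS](size_iota 0); apply/eqP; rewrite -all_count.
  by apply/allP => z; rewrite mem_iota add0n.
rewrite [X in _ + X](_ : _ = 0) ?addn0 //.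
apply/eqP; rewrite -leqn0 leqNgt -has_count -all_predC.
by apply/allP => z; rewrite mem_iota /= -leqNgt => /andP[].
Qed.

(* Main.v *)
Require Import Defs.
From mathcomp Require Import all_boot all_order all_algebra.
From mathcomp Require Import zify ring.

(** The zeta map sorts: it reads the steps of a Dyck path [P] by increasing level
    of their starting points ([zeta_sorts_levels]).  Indeed, for a positive hook
    [h] that is maximal modulo [a], [h + a] is the start level of a north step, and
    the [b]-boundary boxes of its row of the core correspond to the east steps that
    start below [h + a] ([lambda_sweep]).  Conjugation rotates the path, so it
    exchanges starts with ends and reverses the order of the levels; the image of
    the conjugate, rotated back, reads the steps of [P] by increasing level of
    their endpoints ([orbit_conjugate_zeta]).

    Hence, the zeta map being injective, it is enough to exhibit one path [P] whose
    steps, read by start level, give [Q], and to read them by end level.  Such a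
    path is described by ranks: a strictly increasing function [f] from ranks to
    levels and a map [p] from ranks to ranks such that [f (p r) - f r] is [b] or
    [- a], as prescribed by the letter of rank [r] of [Q].  No more is needed:
    since [a] and [b] are coprime, following [p] from rank 0 visits all ranks.

    Let [Q] go from valley to valley through blocks of [c] norths followed by [d]
    easts.  If [(d, c)] had level 0, sending the [c] norths to the last [c] ranks of
    the block and the [d] easts to the first [d] ranks would be right.  In
    general, this works for the explicit levels [block_level], except that two
    steps miss their ends: the last north step of the block is too high by the
    level of the valley where the block ends, and the first east step of the next
    block is too low by the same amount.  So put a gap of this size between the two
    blocks and let these steps exchange their ends ([ranking_glue]).  The levels
    still increase strictly, because all lattice points of levels 1 to [k] are
    valleys, so that there is none between the path and the segment joining two
    consecutive valleys ([block_bezout]).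

    The word read by end level is thus obtained from [Q] by exchanging the norths
    and the easts of each block, which puts a peak at every valley, and by then
    flattening each of these peaks.  Below that path lie the boxes southeast of the
    valleys, except those whose upper left corners are the valleys: the union of
    the sets [Uhat], dissected by the sets [Vhat]. *)

Set Implicit Arguments.
Unset Strict Implicit.
Unset Printing Implicit Defensive.

Import Order.TTheory GRing.Theory Num.Theory.

(** * Rows and columns of a lattice word *)

(** The easts before the north step in row [y], i.e. the abscissa of that step.
    On a row that the word does not reach it is the total number of easts, so
    that [aboveE] holds for every [y]. *)
Fixpoint easts_before (w : seq bool) (y : nat) : nat :=
  match w, y with
  | [::], _ => 0
  | true :: w', 0 => 0
  | true :: w', y'.+1 => easts_before w' y'
  | false :: w', _ => (easts_before w' y).+1
  end.

Definition norths_before (w : seq bool) := easts_before (map negb w).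

Lemma easts_before_cat w1 w2 y :
  easts_before (w1 ++ w2) y =
  if y < count_mem true w1 then easts_before w1 y
  else count_mem false w1 + easts_before w2 (y - count_mem true w1).
Proof.
elim: w1 y => [|[] w1 IH] [|y] //=; rewrite ?IH ?subn0 ?addn0 //= ?add1n ?ltnS ?subSS ?add0n //.
by case: ifP.
by case: ifP.
Qed.

Lemma easts_before_le w y : easts_before w y <= count_mem false w.
Proof. by elim: w y => [|[] w IH] [|y] //=; rewrite ?add0n ?add1n ?ltnS. Qed.

Lemma easts_before_homo w : {homo easts_before w : y z / y <= z}.
Proof. by elim: w => [|[] w IH] [|y] [|z] //= yz; rewrite ?ltnS; apply: IH. Qed.

Lemma count_negb w : (count_mem true (map negb w) = count_mem false w)
  * (count_mem false (map negb w) = count_mem true w).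
Proof. by split; rewrite count_map; apply: eq_count => -[]. Qed.

Lemma norths_before_le w x : norths_before w x <= count_mem true w.
Proof. by have := easts_before_le (map negb w) x; rewrite count_negb. Qed.

Lemma size_word (w : seq bool) : size w = count_mem true w + count_mem false w.
Proof. by rewrite -(count_predC (pred1 true)); congr (_ + _); apply: eq_count => -[]. Qed.

Lemma count_take_le (s : bool) w i j : i <= j ->
  count_mem s (take i w) <= count_mem s (take j w).
Proof.
by move=> ij; rewrite -(take_takel w ij) -{2}(cat_take_drop i (take j w)) count_cat leq_addr.
Qed.

(** Crossing of the path by a row and a column: whether a box lies right of the
    north step of its row or below the east step of its column is one and the
    same question.  It lets hooks be read along rows or along columns. *)
Lemma east_before_north w x y :
  x < count_mem false w -> y < count_mem true w ->
  (easts_before w y <= x) = (y < norths_before w x).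
Proof.
rewrite /norths_before; elim: w x y => [|[] w IH] [|x] [|y] //=.
- by rewrite add0n => h1 h2; rewrite IH ?add0n.
- by rewrite add0n => h1 h2; rewrite IH.
- by rewrite add0n add1n => h1 h2; rewrite ltnS IH.
- by rewrite add0n add1n => h1 h2; rewrite ltnS IH.
Qed.

Lemma aboveE w x y : above w x y = (x < easts_before w y).
Proof.
apply/hasP/idP => [[i]|].
  rewrite mem_iota /= add0n ltnS => iw; elim: w i x y {iw} => [|s w IH] [|i] x y //=.
  case: s => /=; rewrite /point /= ?add0n ?add1n.
    case: y => [|y]; first by rewrite ltn0 ?andbF.
    by rewrite ltnS; apply: IH.
  case: x => [_|x]; first by [].
  by rewrite !ltnS; apply: IH.
elim: w x y => [|s w IH] x y //=; case: s => /=.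
  case: y => [//|y] /IH[i]; rewrite !mem_iota !add0n => hi h; exists i.+1; first by rewrite -[_ :: _]/(iota 0 (size w).+2) mem_iota.
  exact: h.
case: x => [_|x].
  by exists 1 => //; rewrite /point /= take0.
rewrite ltnS => /IH[i]; rewrite !mem_iota !add0n => hi h; exists i.+1; first by rewrite -[_ :: _]/(iota 0 (size w).+2) mem_iota.
by rewrite /point /= !add1n; exact: h.
Qed.

Lemma nth_north w i : i < size w ->
  nth false w i = (i \in [seq y + easts_before w y | y <- iota 0 (count_mem true w)]).
Proof.
move=> iw; apply/idP/mapP => [|[y]]; last first.
  rewrite mem_iota /= add0n => yw ->; elim: w y {i iw} yw => [|[] w IH] [|y] //=.
  - by rewrite ?add0n ?add1n ?ltnS; apply: IH.
  - by rewrite add0n => /IH.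
  - by rewrite add0n addnS => /IH.
elim: w i iw => [|s w IH] [|i] //=; first by case: s => // _ _; exists 0; rewrite ?mem_iota.
rewrite ltnS => iw /(IH _ iw)[y]; rewrite mem_iota /= add0n => yw ->.
by case: s; [exists y.+1 | exists y]; rewrite ?mem_iota /= ?addnS.
Qed.

Lemma nth_east w i : i < size w ->
  ~~ nth false w i = (i \in [seq x + norths_before w x | x <- iota 0 (count_mem false w)]).
Proof.
move=> iw; have := @nth_north (map negb w) i.
by rewrite size_map count_negb (nth_map false) // => ->.
Qed.

(** Rotating the grid by 180 degrees exchanges the boxes left and right of the
    north step of a row. *)
Lemma easts_before_rev w y : y < count_mem true w ->
  easts_before (rev w) (count_mem true w - y.+1) + easts_before w y
    = count_mem false w.
Proof.
elim: w y => [|s w IH] y //=; rewrite rev_cons -cats1 easts_before_cat !count_rev.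
case: s => /=; rewrite ?add0n ?add1n.
  case: y => [_|y]; first by rewrite subn1 /= ltnn subnn /= !addn0.
  by rewrite ltnS subSS => yw; rewrite ltn_subrL (leq_ltn_trans _ yw) //= IH.
by move=> yw; rewrite ltn_subrL (leq_ltn_trans _ yw) //= addnS IH.
Qed.

Lemma count_run n :
  (count_mem true (nseq n true) = n) * (count_mem false (nseq n true) = 0) *
  (count_mem true (nseq n false) = 0) * (count_mem false (nseq n false) = n).
Proof. by rewrite !count_nseq /= !mul1n !mul0n. Qed.

Lemma levelE a b x y : level a b (x, y) = ((b * y)%:Z - (a * x)%:Z)%R.
Proof. by []. Qed.

Lemma point_cons s w i : point (s :: w) i.+1 = (~~ s + (point w i).1, s + (point w i).2).
Proof. by case: s. Qed.

Lemma point_north w y : y < count_mem true w ->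
  point w (y + easts_before w y) = (easts_before w y, y).
Proof.
elim: w y => [|[] w IH] [|y] //=; first by rewrite add1n ltnS addSn point_cons => /IH->.
  by rewrite !add0n => /IH; rewrite point_cons add0n => ->.
by rewrite !add0n addnS point_cons => /IH->.
Qed.

Lemma point_negb w i : point (map negb w) i = ((point w i).2, (point w i).1).
Proof. by rewrite /point -map_take !count_negb. Qed.

Lemma point_east w x : x < count_mem false w ->
  point w (x + norths_before w x) = (x, norths_before w x).
Proof.
move=> xw; have := @point_north (map negb w) x; rewrite count_negb => /(_ xw).
by rewrite point_negb; case: (point _ _) => p q [-> ->].
Qed.

Lemma point_step w i : i < size w ->
  point w i.+1 = ((point w i).1 + ~~ nth false w i, (point w i).2 + nth false w i).
Proof.
move=> iw; rewrite /point (take_nth false iw) -cats1 !count_cat /=.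
by case: (nth false w i); rewrite /= ?addn0.
Qed.

(** * Hook lengths from first-column hook lengths *)

Lemma partition_cons h T :
  partition_of_first_column (h :: T)
    = (h - size T) :: partition_of_first_column T.
Proof.
rewrite /partition_of_first_column /= subn1 /=; congr cons.
by rewrite -[1]/(1 + 0) iotaDl -map_comp; apply: eq_map => i /=; rewrite !subSS.
Qed.

Lemma size_partition H : size (partition_of_first_column H) = size H.
Proof. by rewrite size_map size_iota. Qed.

Lemma drop_partition i H :
  drop i (partition_of_first_column H) = partition_of_first_column (drop i H).
Proof.
elim: H i => [|h T IH] i //; rewrite partition_cons.
by case: i => [|i] /=; rewrite ?partition_cons.
Qed.

Lemma path_gtn_size h T : path gtn h T -> size T <= h.
Proof.
elim: T h => [//|t T IH] h /= /andP[th /IH]; lia.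
Qed.

Lemma partition_le h T : path gtn h T ->
  all (fun v => v <= h - size T) (partition_of_first_column T).
Proof.
elim: T h => [//|t T IH] h; rewrite partition_cons /= => /andP[th tT].
have := path_gtn_size tT; have := IH _ tT.
move=> h1 h2; apply/andP; split; first by lia.
by apply: sub_all h1 => v; lia.
Qed.

(** In the row of first-column hook length [h] above the rows with first-column
    hook lengths [T], the hook lengths are the differences [h - g] where [g] runs
    over the gaps below [h], the numbers missing from [T]: the [j]th gap is [j]
    plus the number of rows no longer than [j].  The induction splits the gaps at
    the largest element [t] of [T]; beyond [t] all rows of [T] are counted. *)
Lemma count_gaps (F : pred nat) h T : path gtn h T ->
  count (fun j => F (j + count (fun v => v <= j) (partition_of_first_column T)))
    (iota 0 (h - size T))
  = count (fun g => (g \notin T) && F g) (iota 0 h).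
Proof.
elim: T h => [|t T IH] h.
  by rewrite subn0 => _; apply: eq_count => j /=; rewrite addn0.
rewrite partition_cons [path _ _ _]/= => /andP[th tT]; have tS := path_gtn_size tT.
have tTlt g : g \in T -> g < t.
  by move: tT => /(order_path_min (rev_trans ltn_trans))/allP h1 /h1.
have {2}-> : h = t + (1 + (h - t.+1)) by lia.
have -> : h - size (t :: T) = (t - size T) + (h - t.+1) by rewrite /=; lia.
rewrite !iotaD !count_cat; congr (_ + _).
  transitivity (count (fun g => (g \notin T) && F g) (iota 0 t)); last first.
    apply: eq_in_count => g; rewrite mem_iota add0n inE => /andP[_ gt].
    by rewrite (ltn_eqF gt).
  rewrite -IH //; apply: eq_in_count => j; rewrite mem_iota add0n => /andP[_ jt] /=.
  by rewrite leqNgt jt.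
rewrite [X in _ = X + _]/= inE eqxx !add0n.
have -> : iota (t + 1) (h - t.+1)
    = map (addn (size T).+1) (iota (t - size T) (h - t.+1)).
  by rewrite -iotaDl; congr iota; lia.
rewrite count_map; apply: eq_in_count => j; rewrite mem_iota => /andP[tj _] /=.
rewrite tj.
have -> : count (fun v => v <= j) (partition_of_first_column T) = size T.
  apply/eqP; rewrite -[in X in _ == X](size_partition T) -all_count.
  by apply: sub_all (partition_le tT) => v /leq_trans->.
have -> : j + (1 + size T) = (size T).+1 + j by lia.
rewrite inE (_ : (_ == t) = false) /=; last by lia.
by case: ((size T).+1 + j \in T) (@tTlt ((size T).+1 + j)) => // /(_ isT); lia.
Qed.

(** The rows above row [i] have larger first-column hook lengths, so the gaps
    below that of row [i] are the same for the whole partition as for the rows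
    under it. *)
Lemma m_boundary_gaps b H i : sorted gtn H -> i < size H ->
  m_boundary_in_row b (partition_of_first_column H) i
  = count (fun g => (g \notin H) && (nth 0 H i - g < b)) (iota 0 (nth 0 H i)).
Proof.
move=> sH iH; set h := nth 0 H i; pose T := drop i.+1 H.
have dE : drop i H = h :: T by rewrite (drop_nth 0 iH).
have hT : path gtn h T by have := drop_sorted i sH; rewrite dE.
have dK : drop i (partition_of_first_column H)
    = (h - size T) :: partition_of_first_column T.
  by rewrite drop_partition dE partition_cons.
have nK : nth 0 (partition_of_first_column H) i = h - size T.
  by rewrite -[i]addn0 -nth_drop dK.
have dKS : drop i.+1 (partition_of_first_column H) = partition_of_first_column T.
  by rewrite -add1n -drop_drop dK /= drop0.
rewrite /m_boundary_in_row nK /hook nK dKS.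
transitivity (count (fun g => (g \notin T) && (h - g < b)) (iota 0 h)).
  rewrite -(count_gaps (fun g => h - g < b) hT); apply: eq_in_count => j.
  rewrite mem_iota add0n => /andP[_ jh].
  have := count_predC (fun v => v <= j) (partition_of_first_column T).
  rewrite size_partition.
  have -> : count (predC (fun v => v <= j)) (partition_of_first_column T)
     = count (fun v => j < v) (partition_of_first_column T).
    by apply: eq_count => v /=; rewrite ltnNge.
  by move: (count _ _) (count _ _) => m1 m2; lia.
apply: eq_in_count => g; rewrite mem_iota add0n => /andP[_ gh].
congr (~~ _ && _); rewrite -(cat_take_drop i H) dE mem_cat inE (ltn_eqF gh) /=.
case: (boolP (g \in take i H)) => //= gi.
have := sH; rewrite -{1}(cat_take_drop i H) dE (sorted_pairwise (rev_trans ltn_trans)).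
rewrite pairwise_cat => /and3P[/allrelP/(_ g h gi (mem_head _ _))/= hg _ _].
by have := ltn_trans gh hg; rewrite ltnn.
Qed.

Lemma count_split (T : Type) (p A : pred T) s :
  count A s = count (fun x => A x && p x) s + count (fun x => A x && ~~ p x) s.
Proof. by elim: s => //= x s ->; case: (A x) (p x) => -[] /=; lia. Qed.

(** If the gaps of [H] are closed under adding [b], those in the window
    [h - b < g < h] are as many as the generators below [h], the gaps [e] for
    which [e - b] is not a gap: below [h], the gaps that are not generators are
    the translates by [b] of the gaps outside the window. *)
Lemma count_generators (H E : seq nat) b h : 0 < b -> uniq E ->
  (forall g, g \notin H -> g + b \notin H) ->
  (forall g, (g \in E) = (g \notin H) && ((g < b) || (g - b \in H))) ->
  h \in H ->
  count (fun g => (g \notin H) && (h - g < b)) (iota 0 h) = count (fun e => e < h) E.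
Proof.
move=> b0 uE cl hE hH.
have -> : count (fun e => e < h) E = count (fun g => g \in E) (iota 0 h).
  rewrite -!size_filter; apply: perm_size; apply: uniq_perm.
  - exact: filter_uniq.
  - by rewrite filter_uniq ?iota_uniq.
  by move=> g; rewrite !mem_filter mem_iota andbC.
pose A g := g \notin H.
have eA : count (fun g => A g && (b <= h - g)) (iota 0 h)
        = count (fun g => A g && (g \notin E)) (iota 0 h).
  case: (leqP b h) => bh; last first.
    rewrite !(@eq_in_count _ _ pred0) // => g; rewrite mem_iota add0n => /andP[_ gh] /=.
      by rewrite hE -/(A g) (_ : g < b) ?orTb ?andbT ?andbN //; lia.
    by rewrite (_ : (b <= h - g) = false) ?andbF //; lia.
  have -> : count (fun g => A g && (g \notin E)) (iota 0 h)
     = count A (iota 0 (h - b)).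
    rewrite -{1}(subnKC bh) iotaD count_cat (@eq_in_count _ _ pred0) ?count_pred0; last first.
      move=> g; rewrite mem_iota add0n => /andP[_ gb] /=.
      by rewrite hE -/(A g) gb orTb andbT andbN.
    rewrite !add0n -{1}[b]addn0 iotaDl count_map; apply: eq_count => g /=.
    rewrite hE -/(A (b + g)) addKn (_ : (b + g < b) = false) /=; last by lia.
    rewrite negb_and -/(A g); case: (boolP (A g)) => Ag; last by rewrite orbF andbN.
    by have := cl _ Ag; rewrite addnC -/(A _) => ->; rewrite orbT.
  rewrite -{2}(subnK bh) iotaD count_cat -[RHS]addn0; congr (_ + _).
    apply: eq_in_count => g; rewrite mem_iota add0n => /andP[_ gh].
    by rewrite (_ : b <= h - g) ?andbT //; lia.
  apply/eqP; rewrite -leqn0 leqNgt -has_count; apply/hasPn => g.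
  rewrite mem_iota add0n => /andP[gh _]; apply/negP => /andP[Ag bg].
  have ge : g = h - b by lia.
  by have := cl _ Ag; rewrite ge subnK // hH.
have := count_split (fun g => b <= h - g) A (iota 0 h).
have := count_split (mem E) A (iota 0 h); rewrite /= -eA => -> /eqP.
rewrite [X in _ == X]addnC eqn_add2r => /eqP e.
rewrite (@eq_in_count _ _ (fun g => A g && ~~ (b <= h - g))); last first.
  by move=> g _; rewrite ltnNge.
by rewrite -e; apply: eq_count => g /=; rewrite hE -/(A g); case: (A g).
Qed.

(** * Levels and positive hooks of a Dyck path *)

Record dyck_word (a b : nat) (w : seq bool) : Prop := DyckWord {
  dw_norths : count_mem true w = a;
  dw_easts : count_mem false w = b;
  dw_level : forall i, i <= size w -> a * (point w i).1 <= b * (point w i).2 }.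

Lemma dyckP a b (P : lpath a b) : reflect (dyck_word a b P) (P \in dyck a b).
Proof.
rewrite inE; apply: (iffP andP) => [[/eqP hN /allP hD]|[hN hE hD]].
  split=> //.
    by have := size_word P; rewrite size_tuple hN; lia.
  move=> i; rewrite size_tuple => iP.
  have /hD : i \in iota 0 (a + b).+1 by rewrite mem_iota; lia.
  by rewrite /level; lia.
split; first by apply/eqP.
apply/allP => i; rewrite mem_iota => iP; rewrite /level.
by have {}hD := hD i; rewrite size_tuple in hD; have := hD iP; lia.
Qed.

(** A level determines the ordinate modulo [a]. *)
Lemma lattice_inj a b x y x' y' : coprime a b -> y < a -> y' < a ->
  b * y + a * x' = b * y' + a * x -> y = y'.
Proof.
move=> hab; wlog yy : x x' y y' / y <= y' => [hw ya y'a e|ya y'a e].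
  by case: (leqP y y') => [yy|/ltnW yy]; [exact: hw e | exact/esym/(hw _ _ _ _ yy y'a ya (esym e))].
have : a %| b * (y' - y) by apply/dvdnP; exists (x' - x); rewrite mulnBr mulnBl; lia.
rewrite Gauss_dvdr //; case: (posnP (y' - y)) => [|h /(dvdn_leq h)]; lia.
Qed.

Definition start_level (a b : nat) (w : seq bool) (i : nat) :=
  b * (point w i).2 - a * (point w i).1.

Definition start_levels (a b : nat) (w : seq bool) (s : bool) :=
  [seq start_level a b w i | i <- iota 0 (size w) & nth false w i == s].

(** The vertices of a Dyck path have distinct levels, except for its two
    endpoints; hence the levels can be used to rank its steps. *)
Lemma start_level_inj a b w i j : 0 < a -> coprime a b -> dyck_word a b w ->
  i < size w -> j < size w -> start_level a b w i = start_level a b w j -> i = j.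
Proof.
move=> a0 hab [hN hE hD]; wlog ij : i j / i <= j => [hw iw jw e|iw jw e].
  by case: (leqP i j) => [ij|/ltnW ij]; [exact: hw e | exact/esym/(hw _ _ ij jw iw (esym e))].
have sP k : k <= size w -> (point w k).2 + (point w k).1 = k.
  by move=> kw; rewrite /point /= -size_word size_takel.
have yy : (point w i).2 <= (point w j).2 := count_take_le true w ij.
have xx : (point w i).1 <= (point w j).1 := count_take_le false w ij.
have ya : (point w j).2 <= a by have := count_take_le true w (ltnW jw); rewrite take_size hN.
move: xx yy ya.
have := sP _ (ltnW iw); have := sP _ (ltnW jw).
have := hD _ (ltnW iw); have := hD _ (ltnW jw).
move: e jw; rewrite /start_level size_word hN hE.
case: (point w i) (point w j) => x y [x' y'] /= e jw dj di sj si xx yy ya.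
have eq : b * (y' - y) = a * (x' - x) by rewrite !mulnBr; lia.
case: (leqP a (y' - y)) => h.
  have : b <= x' - x by rewrite -(leq_pmul2l a0) -eq mulnC leq_mul2l h orbT.
  by lia.
have y0 : y' - y = 0.
  by apply: (@lattice_inj a b (x' - x) _ 0 0 hab h a0); rewrite !muln0 addn0 add0n.
have : x' - x = 0 by apply/eqP; rewrite -(eqn_pmul2l a0) -eq y0 !muln0.
by lia.
Qed.

Lemma mem_hooks a b w h : reflect
  (exists x y, [/\ 0 < h, x < b, y < a, easts_before w y <= x & h + a * x.+1 = b * y])
  (h \in positive_hooks a b w).
Proof.
rewrite mem_sort; apply: (iffP mapP) => [[[x y]]|[x [y [h0 xb ya xx e]]]].
  rewrite mem_filter /= aboveE -leqNgt /level /= => /andP[/andP[xx lp] /allpairsP[[x' y']]].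
  rewrite !mem_iota /= => -[xb ya [ex ey]]; subst x' y' => he.
  by exists x, y; split=> //; lia.
exists (x, y); last by rewrite /level /=; lia.
rewrite mem_filter aboveE -leqNgt xx /level /= allpairs_f ?mem_iota //.
by rewrite andbT; lia.
Qed.

Lemma hooks_sorted a b w : coprime a b -> sorted gtn (positive_hooks a b w).
Proof.
move=> hab; rewrite /positive_hooks; set s := map _ _.
have us : uniq s.
  rewrite map_inj_in_uniq; first by rewrite filter_uniq // allpairs_uniq ?iota_uniq // => -[? ?] [].
  move=> [x y] [x' y']; rewrite !mem_filter /= /level /=.
  move=> /andP[/andP[_ lp] /allpairsP[[x1 y1]]]; rewrite !mem_iota /= => -[xb ya [ex ey]].
  move=> /andP[/andP[_ lp'] /allpairsP[[x2 y2]]]; rewrite !mem_iota /= => -[xb' ya' [ex' ey']] e.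
  rewrite add0n -ey in ya; rewrite add0n -ey' in ya'.
  have e' : b * y + a * x'.+1 = b * y' + a * x.+1 by lia.
  have yy := lattice_inj hab ya ya' e'; move: e'; rewrite yy => /addnI/eqP.
  by rewrite eqn_pmul2l ?(leq_ltn_trans _ ya) // eqSS => /eqP->.
rewrite gtn_sorted_uniq_geq sort_uniq us.
by apply: sort_sorted => m n; apply: leq_total.
Qed.

Lemma hooks_gt0 a b w : 0 \notin positive_hooks a b w.
Proof. by apply/mem_hooks => -[x [y []]]. Qed.

Lemma mem_start_north a b w s : dyck_word a b w -> reflect
  (exists2 y, y < a & s + a * easts_before w y = b * y)
  (s \in start_levels a b w true).
Proof.
move=> [hN hE hD]; apply: (iffP mapP) => [[i]|[y ya e]].
  rewrite mem_filter mem_iota eqb_id => /andP[wi iw] ->.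
  move: wi; rewrite nth_north // => /mapP[y]; rewrite mem_iota hN add0n => ya iE.
  exists y => //; have := hD i (ltnW iw); rewrite /start_level iE point_north ?hN //=; lia.
have yN : y < count_mem true w by rewrite hN.
have iw : y + easts_before w y < size w.
  by rewrite size_word -addSn leq_add // easts_before_le.
exists (y + easts_before w y); last by rewrite /start_level point_north //=; lia.
rewrite mem_filter eqb_id mem_iota iw nth_north //; apply/andP; split=> //.
by apply/mapP; exists y; rewrite ?mem_iota.
Qed.

Lemma mem_start_east a b w s : dyck_word a b w -> reflect
  (exists2 x, x < b & s + a * x = b * norths_before w x)
  (s \in start_levels a b w false).
Proof.
move=> [hN hE hD]; apply: (iffP mapP) => [[i]|[x xb e]].
  rewrite mem_filter mem_iota eqbF_neg => /andP[wi iw] ->.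
  move: wi; rewrite nth_east // => /mapP[x]; rewrite mem_iota hE add0n => xb iE.
  exists x => //; have := hD i (ltnW iw); rewrite /start_level iE point_east ?hE //=; lia.
have xE : x < count_mem false w by rewrite hE.
have iw : x + norths_before w x < size w.
  rewrite size_word addnC -addnS leq_add //; have := easts_before_le (map negb w) x.
  by rewrite count_negb.
exists (x + norths_before w x); last by rewrite /start_level point_east //=; lia.
rewrite mem_filter eqbF_neg mem_iota iw nth_east //; apply/andP; split=> //.
by apply/mapP; exists x; rewrite ?mem_iota.
Qed.

Lemma end_east a b w x : dyck_word a b w -> x < b -> a * x.+1 <= b * norths_before w x.
Proof.
move=> [hN hE hD] xb; have xE : x < count_mem false w by rewrite hE.
have iw : x + norths_before w x < size w.
  rewrite size_word addnC -addnS leq_add //; have := easts_before_le (map negb w) x.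
  by rewrite count_negb.
have := hD _ iw; rewrite point_step // point_east //=.
have -> : nth false w (x + norths_before w x) = false.
  apply/negbTE; rewrite nth_east //; apply/mapP; exists x => //.
  by rewrite mem_iota.
by rewrite addn0 addn1.
Qed.

Definition end_levels (a b : nat) (w : seq bool) :=
  [seq s - a | s <- start_levels a b w false].

Lemma mem_end_levels a b w e : dyck_word a b w -> reflect
  (exists2 x, x < b & e + a * x.+1 = b * norths_before w x)
  (e \in end_levels a b w).
Proof.
move=> dw; apply: (iffP mapP) => [[s /(mem_start_east _ dw)[x xb es] ->]|[x xb ee]].
  by exists x => //; have := end_east dw xb; rewrite mulnS; lia.
exists (e + a); last by rewrite addnK.
by apply/(mem_start_east _ dw); exists x => //; rewrite -ee mulnS; lia.
Qed.

Lemma start_east_ge a b w s : dyck_word a b w ->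
  s \in start_levels a b w false -> a <= s.
Proof.
by move=> dw /(mem_start_east _ dw)[x xb es]; have := end_east dw xb; rewrite mulnS; lia.
Qed.

Lemma start_levels_uniq a b w s : 0 < a -> coprime a b -> dyck_word a b w ->
  uniq (start_levels a b w s).
Proof.
move=> a0 hab dw; rewrite map_inj_in_uniq ?filter_uniq ?iota_uniq // => i j.
rewrite !mem_filter !mem_iota !add0n => /and3P[_ _ iw] /and3P[_ _ jw].
exact: start_level_inj hab dw iw jw.
Qed.

Lemma end_levels_uniq a b w : 0 < a -> coprime a b -> dyck_word a b w ->
  uniq (end_levels a b w).
Proof.
move=> a0 hab dw; rewrite map_inj_in_uniq ?start_levels_uniq // => s t.
by move=> /(start_east_ge dw) ? /(start_east_ge dw) ?; lia.
Qed.

Lemma hooks_addb a b w g : coprime a b -> 0 < b ->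
  g \notin positive_hooks a b w -> g + b \notin positive_hooks a b w.
Proof.
move=> hab b0; apply: contra => /mem_hooks[x [y [_ xb ya xx e]]].
have y0 : 0 < y by case: (y) e => //; rewrite muln0; lia.
have e' : g + a * x.+1 = b * y.-1 by rewrite -(subn1 y) mulnBr muln1; lia.
apply/mem_hooks; exists x, y.-1; split=> //; last first.
- by apply: leq_trans xx; apply: easts_before_homo; lia.
- by lia.
rewrite lt0n; apply/eqP => g0; rewrite g0 add0n in e'.
have bx : b <= x.+1.
  rewrite dvdn_leq // -(@Gauss_dvdr _ a) 1?coprime_sym // e' dvdn_mulr //.
have : a * b <= b * y.-1 by rewrite -e' leq_mul2l bx orbT.
by rewrite mulnC leq_pmul2l //; lia.
Qed.

(** Every level occurs on the right side of exactly one column; here is the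
    existence, by a Bezout relation. *)
Lemma hook_residue a b g : coprime a b -> 0 < b ->
  exists x y, x < b /\ g + a * x.+1 = b * y.
Proof.
move=> hab b0; case: (posnP a) => a0.
  by exists 0, g; split=> //; move: hab; rewrite a0 /coprime gcd0n => /eqP->; lia.
have [u v uv _] := egcdnP a b0; rewrite gcdnC (eqP hab) in uv.
(* As [u * b = v * a + 1], the number [g + a * (g * v)] is a multiple of [b]. *)
pose t := g * v + b.-1; exists (t %% b).
have : b %| g + a * (t %% b).+1.
  rewrite -(@dvdn_addl (a * (t %/ b * b))); last by rewrite mulnA dvdn_mull.
  have -> : g + a * (t %% b).+1 + a * (t %/ b * b) = g + a * t.+1.
    by rewrite -addnA -mulnDr addSn; congr (_ + _ * _.+1); rewrite addnC -divn_eq.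
  have -> : g + a * t.+1 = b * (g * u + a) by rewrite /t -addnS prednK //; nia.
  exact: dvdn_mulr.
by case/dvdnP => y e; exists y; rewrite e mulnC ltn_pmod.
Qed.

(** Column by column, the positive hooks are the positive numbers obtained by
    subtracting multiples of [b] from the end level of the east step of the
    column.  Since every residue modulo [b] belongs to one column, the end levels
    of east steps are exactly the generators of the gaps for adding [b]. *)
Lemma mem_end_levels_hooks a b w g : 0 < a -> 0 < b -> coprime a b -> dyck_word a b w ->
  (g \in end_levels a b w) = (g \notin positive_hooks a b w)
    && ((g < b) || (g - b \in positive_hooks a b w)).
Proof.
move=> a0 b0 hab dw; have [hN hE hD] := dw.
have hba : coprime b a by rewrite coprime_sym.
have dual x y : x < b -> y < a -> (easts_before w y <= x) = (y < norths_before w x).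
  by move=> xb ya; rewrite east_before_north ?hN ?hE.
have Yle x : norths_before w x <= a by rewrite -hN norths_before_le.
apply/idP/andP => [/(mem_end_levels _ dw)[x xb e]|[gH]].
  split.
    apply/mem_hooks => -[x' [y [g0 xb' ya]]]; rewrite dual // => yY e'.
    have ee : a * x.+1 + b * y = a * x'.+1 + b * norths_before w x by lia.
    have xx : x = x' by apply: (@lattice_inj b a (norths_before w x) _ y _ hba xb xb'); lia.
    move: ee yY; rewrite xx => /addnI/eqP; rewrite eqn_pmul2l // => /eqP->.
    by rewrite ltnn.
  case: (ltnP g b) => //= bg; apply/mem_hooks; exists x, (norths_before w x).-1.
  have Y0 : 0 < norths_before w x by case: (norths_before w x) e; lia.
  have e' : g - b + a * x.+1 = b * (norths_before w x).-1.
    by rewrite -(subn1 (norths_before _ _)) mulnBr muln1 -e; lia.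
  have := Yle x => YY.
  split=> //; last by rewrite dual //; lia.
  - rewrite lt0n; apply/eqP => g0; rewrite g0 add0n in e'.
    have bx : b <= x.+1.
      by rewrite dvdn_leq // -(@Gauss_dvdr _ a) 1?coprime_sym // e' dvdn_mulr.
    have : a * b <= b * (norths_before w x).-1 by rewrite -e' leq_mul2l bx orbT.
    by rewrite mulnC leq_pmul2l //; lia.
  - lia.
case/orP => [gb|/mem_hooks[x [y [g0 xb ya]]]]; last first.
  rewrite dual // => yY e; apply/(mem_end_levels _ dw); exists x => //.
  have bg : b <= g by lia.
  have eg : g + a * x.+1 = b * y.+1 by rewrite mulnS; lia.
  case: (ltnP y.+1 (norths_before w x)) => yY'.
    case/negP: gH; apply/mem_hooks; exists x, y.+1; split=> //; first by lia.
      by have := Yle x; lia.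
    by rewrite dual //; have := Yle x; lia.
  by have <- : y.+1 = norths_before w x by lia.
have [x [y [xb e]]] := hook_residue g hab b0.
have Yx := end_east dw xb.
apply/(mem_end_levels _ dw); exists x => //; rewrite e; congr (b * _).
apply/eqP; rewrite eqn_leq; apply/andP; split.
  rewrite -ltnS -(ltn_pmul2l b0) mulnS; lia.
rewrite leqNgt; apply/negP => yY; have Ya := Yle x.
case: (posnP g) => g0; last first.
  by case/negP: gH; apply/mem_hooks; exists x, y; split=> //; rewrite ?dual //; lia.
rewrite g0 add0n in e.
have bx : b <= x.+1.
  by rewrite dvdn_leq // -(@Gauss_dvdr _ a) 1?coprime_sym // e dvdn_mulr.
have : a * b <= b * y by rewrite -e leq_mul2l bx orbT.
by rewrite mulnC leq_pmul2l //; lia.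
Qed.

(** Row by row, the positive hooks are the positive numbers obtained by
    subtracting multiples of [a] from the start level of the north step of the
    row.  The largest hooks of their classes modulo [a] thus correspond to the
    north steps that start above level [a]. *)
Lemma mem_hooks_start_north a b w h : 0 < a -> coprime a b -> dyck_word a b w ->
  (h \in positive_hooks a b w) && (h + a \notin positive_hooks a b w)
   = (0 < h) && (h + a \in start_levels a b w true).
Proof.
move=> a0 hab dw.
apply/andP/andP => [[/mem_hooks[x [y [h0 xb ya xx e]]] hH]|[h0 /(mem_start_north _ dw)[y ya e]]].
  split=> //; apply/(mem_start_north _ dw); exists y => //.
  case: (ltnP (easts_before w y) x) => xx'; last first.
    have -> : easts_before w y = x by lia.
    by rewrite -e mulnS; lia.
  case/negP: hH; apply/mem_hooks; exists x.-1, y; split=> //; try lia.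
  by rewrite -e prednK ?mulnS; lia.
have xb : easts_before w y < b.
  have h1 : b * y <= b * a by rewrite leq_mul // ltnW.
  by rewrite -(ltn_pmul2l a0); lia.
split; first by apply/mem_hooks; exists (easts_before w y), y; split=> //; rewrite -e mulnS; lia.
apply/mem_hooks => -[x' [y' [_ xb' ya' xx' e']]].
have yy : y = y' by apply: (lattice_inj hab ya ya' (x' := x'.+1) (x := easts_before w y)); lia.
move: e e'; rewrite yy => <- /addnI/eqP; rewrite eqn_pmul2l // => /eqP; lia.
Qed.

(** * The zeta map sorts the steps by level *)

Lemma hook_core a b w i : coprime a b -> i < size (positive_hooks a b w) ->
  hook (core a b w) i 0 = nth 0 (positive_hooks a b w) i.
Proof.
move=> hab iH; have := first_columnK (hooks_sorted w hab) (hooks_gt0 a b w).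
move/(congr1 (nth 0 ^~ i)); rewrite /first_column (nth_map 0) ?size_iota ?size_partition //.
by rewrite nth_iota ?size_partition.
Qed.

(** The hooks of a class modulo [a] go down to the smallest positive one without
    a jump, so [h] is the largest of its class as soon as [h + a] is no hook. *)
Lemma m_rows_core a b w : 0 < a -> coprime a b ->
  m_rows a (core a b w) =
  [seq i <- iota 0 (size (positive_hooks a b w)) |
     nth 0 (positive_hooks a b w) i + a \notin positive_hooks a b w].
Proof.
move=> a0 hab; rewrite /m_rows size_partition.
apply: eq_in_filter => i; rewrite mem_iota add0n => /andP[_ iH].
set H := positive_hooks a b w in iH *.
have hiH : nth 0 H i \in H by apply: mem_nth.
apply/allP/idP => [h|ha r].
  apply/negP => /(nthP 0)[r rH re]; have := h r; rewrite mem_iota rH => /(_ isT).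
  by rewrite !hook_core // -/H re modnDr eqxx /=; lia.
rewrite mem_iota add0n => /andP[_ rH]; rewrite !hook_core // -/H.
apply/implyP => /eqP e; rewrite leqNgt; apply/negP => lt.
have /mem_hooks[x [y [h0 xb ya xx he]]] : nth 0 H r \in H by apply: mem_nth.
have /mem_hooks[x1 [y1 [h1 _ _ _ _]]] := hiH.
(* Row [y] meets the box of hook [h + a], [t] columns to the right of the box
   of the larger hook. *)
have [t tE] : exists t, nth 0 H r = nth 0 H i + a * t.+1.
  have /dvdnP[t tE] : a %| nth 0 H r - nth 0 H i.
    by rewrite -eqn_mod_dvd ?(ltnW lt) // e.
  by exists t.-1; case: t tE => [|t] /= tE; [lia | rewrite [a * _]mulnC -tE; lia].
case/negP: ha; apply/mem_hooks; exists (x + t), y; split=> //; last first.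
- by rewrite -he tE; lia.
- by apply: leq_trans xx (leq_addr _ _).
- have h2 : b * y <= b * a by rewrite leq_mul // ltnW.
  by rewrite -(ltn_pmul2l a0); lia.
by lia.
Qed.

(** The part of the zeta partition for the north step starting at level [s] is
    the number of east steps that start below [s].  An [a]-row of first-column
    hook length [h] comes from the north step starting at [s = h + a], and its
    [b]-boundary boxes are counted by the east steps ending below [h].  The north
    steps with [s <= a] give no row, but they give the padding zeros, because east
    steps start at level [a] or higher. *)
Lemma lambda_sweep a b w : 0 < a -> 0 < b -> coprime a b -> dyck_word a b w ->
  lambda a b w = sort geq [seq count (fun e => e < s) (start_levels a b w false)
                          | s <- start_levels a b w true].
Proof.
move=> a0 b0 hab dw; set NS := start_levels a b w true.
set ES := start_levels a b w false; pose H := positive_hooks a b w.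
pose F s := count (fun e => e < s) ES.
have ESE : ES = [seq e + a | e <- end_levels a b w].
  rewrite /end_levels -map_comp -[LHS]map_id; apply/eq_in_map => s sE /=.
  by rewrite subnK // (start_east_ge dw).
have sH := hooks_sorted w hab : sorted gtn H.
have partsE : [seq m_boundary_in_row b (core a b w) i | i <- m_rows a (core a b w)]
   = [seq F (h + a) | h <- H & h + a \notin H].
  rewrite m_rows_core // -/H.
  have -> : [seq h <- H | h + a \notin H]
      = map (nth 0 H) [seq i <- iota 0 (size H) | nth 0 H i + a \notin H].
    by rewrite -[X in filter _ X](mkseq_nth 0) /mkseq filter_map.
  rewrite -map_comp; apply/eq_in_map => i.
  rewrite mem_filter mem_iota add0n /= => /andP[_ iH].
  rewrite m_boundary_gaps // (count_generators (E := end_levels a b w)) //.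
  - by rewrite /F ESE count_map; apply: eq_count => e /=; rewrite ltn_add2r.
  - exact: end_levels_uniq.
  - by move=> g; apply: hooks_addb.
  - by move=> g; apply: mem_end_levels_hooks.
  - exact: mem_nth.
(* Rows of the core against north steps starting above level [a]. *)
have perm1 : perm_eq [seq F (h + a) | h <- H & h + a \notin H] [seq F s | s <- NS & a < s].
  have -> : [seq F (h + a) | h <- H & h + a \notin H]
    = map F [seq h + a | h <- H & h + a \notin H] by rewrite -map_comp.
  apply: perm_map; apply: uniq_perm.
  - rewrite map_inj_uniq; last exact: addIn.
    by rewrite filter_uniq //; move: sH; rewrite gtn_sorted_uniq_geq => /andP[].
  - by rewrite filter_uniq // start_levels_uniq.
  move=> s; apply/mapP/idP => [[h] | ].
    rewrite mem_filter andbC mem_hooks_start_north // => /andP[h0 hN] ->.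
    by rewrite mem_filter hN andbT; lia.
  rewrite mem_filter => /andP[sa sN]; exists (s - a); last by rewrite subnK // ltnW.
  by rewrite mem_filter andbC mem_hooks_start_north // subnK ?(ltnW sa) // sN subn_gt0 sa.
(* North steps starting at level [a] or lower precede all east steps. *)
have zeros : [seq F s | s <- NS & ~~ (a < s)] = nseq (size [seq s <- NS | ~~ (a < s)]) 0.
  have -> : size [seq s <- NS | ~~ (a < s)] = size [seq F s | s <- NS & ~~ (a < s)].
    by rewrite size_map.
  apply/all_pred1P/allP => _ /mapP[s + ->]; rewrite mem_filter -leqNgt => /andP[sa _] /=.
  rewrite /F -leqn0 leqNgt -has_count; apply/hasPn => e /(start_east_ge dw) ae.
  by rewrite -leqNgt (leq_trans sa).
have szNS : size NS = a.
  rewrite size_map size_filter -(dw_norths dw) -[in RHS](mkseq_nth false w) count_map.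
  by apply: eq_count.
set X := [seq F (h + a) | h <- H & h + a \notin H] in perm1 partsE.
have szX : a - size (sort geq X) = size [seq s <- NS | ~~ (a < s)].
  rewrite size_sort (perm_size perm1) size_map.
  have := perm_size (permEl (perm_filterC (fun s => a < s) NS)); rewrite size_cat szNS /= => e.
  by rewrite -[X in X - _]e addKn.
rewrite /lambda partsE szX -zeros.
have tot : total geq by move=> m n; apply: leq_total.
apply: (@sorted_eq _ geq); first exact: rev_trans leq_trans.
- by move=> m n; rewrite andbC => /anti_leq.
- rewrite zeros sorted_pairwise; last exact: rev_trans leq_trans.
  rewrite pairwise_cat -!sorted_pairwise; try exact: rev_trans leq_trans.
  rewrite sort_sorted //=; apply/andP; split.
    by apply/allrelP => m n _ /nseqP[-> _].
  by elim: (size _) => //= -[|n].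
- exact: sort_sorted.
have p0 := perm_map F (permEl (perm_filterC (fun s => a < s) NS)).
rewrite map_cat perm_sym in p0; rewrite perm_sym.
apply: perm_trans (permEl (perm_sort _ _)) (perm_trans p0 _).
rewrite perm_cat2r perm_sym; exact: perm_trans (permEl (perm_sort _ _)) perm1.
Qed.

Lemma increasing_lt (f : nat -> int) n : (forall r, r.+1 < n -> (f r < f r.+1)%R) ->
  forall r s, r < n -> s < n -> (f r < f s)%R = (r < s).
Proof.
move=> inc; have lt r s : r < s -> s < n -> (f r < f s)%R.
  elim: s => [//|s IH]; rewrite ltnS leq_eqVlt => /predU1P[->|rs] sn; first exact: inc.
  by apply: lt_trans (IH rs (ltnW sn)) (inc _ sn).
move=> r s rn sn; case: (ltngtP r s) => [rs|sr|->]; last exact: ltxx.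
  by rewrite lt.
by apply/negbTE; rewrite -leNgt ltW // lt.
Qed.

Lemma easts_count (w : seq bool) r : r <= size w ->
  (point w r).1 = count (fun i => nth false w i == false) (iota 0 r).
Proof.
move=> rw; rewrite /point /= -[in LHS](mkseq_nth false w) /mkseq -map_take take_iota (minn_idPl rw).
by rewrite count_map.
Qed.

Lemma count_positions (w : seq bool) (s : bool) :
  count (fun i => nth false w i == s) (iota 0 (size w)) = count_mem s w.
Proof. by rewrite -[in RHS](mkseq_nth false w) count_map. Qed.

Lemma bounding_path_easts a b (W : seq bool) (mu : seq nat) :
  size W = a + b -> count_mem true W = a ->
  (forall y, y < a -> nth 0 mu (a - y.+1) = easts_before W y) ->
  bounding_path a b mu = W :> seq bool.
Proof.
move=> sW cW muE; apply: (@eq_from_nth _ false); first by rewrite size_tuple sW.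
move=> i; rewrite size_tuple => iab; have -> : nth false (bounding_path a b mu) i = tnth (bounding_path a b mu) (Ordinal iab).
  by rewrite (tnth_nth false).
rewrite tnth_mktuple.
rewrite nth_north ?sW // cW /=; congr (_ \in _).
by apply/eq_in_map => y; rewrite mem_iota add0n => /andP[_ ya]; rewrite muE.
Qed.

(** The zeta map as a sorting of steps: if the [i]th step of [P] is the letter of
    rank [rho i] in [W], and the start levels increase with the rank, then the
    image of [P] is [W], the steps of [P] read by increasing start level. *)
Lemma zeta_sorts_levels a b (P : lpath a b) (W : seq bool) (f : nat -> int) (rho : nat -> nat) :
  0 < a -> 0 < b -> coprime a b -> P \in dyck a b -> size W = a + b ->
  (forall r, r.+1 < a + b -> (f r < f r.+1)%R) ->
  (forall i, i < a + b -> rho i < a + b) ->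
  (forall i, i < a + b -> level a b (point P i) = f (rho i)) ->
  (forall i, i < a + b -> nth false P i = nth false W (rho i)) ->
  zeta P = W :> seq bool.
Proof.
move=> a0 b0 hab /dyckP dw sW inc rhon lvl stp.
have sP : size P = (a + b) by rewrite size_tuple.
have slE i : i < (a + b) -> (start_level a b P i)%:Z%R = f (rho i).
  move=> iP; have := dw_level dw (i := i); rewrite sP => /(_ (ltnW iP)) h.
  by rewrite -lvl // /level /start_level; lia.
have rinj : {in iota 0 (a + b) &, injective rho}.
  move=> i j; rewrite !mem_iota !add0n => /andP[_ ip] /andP[_ jp] e.
  apply: (start_level_inj a0 hab dw); rewrite ?sP //.
  by apply/eqP; rewrite -eqz_nat !slE // e.
(* Distinct start levels make [rho] injective, hence a permutation. *)
have rperm : perm_eq (map rho (iota 0 (a + b))) (iota 0 (a + b)).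
  have um : uniq (map rho (iota 0 (a + b))) by rewrite map_inj_in_uniq ?iota_uniq.
  apply: uniq_perm; rewrite ?iota_uniq //.
  have sub : {subset map rho (iota 0 (a + b)) <= iota 0 (a + b)}.
    by move=> _ /mapP[i + ->]; rewrite !mem_iota !add0n; apply: rhon.
  have sz : size (iota 0 (a + b)) <= size (map rho (iota 0 (a + b))) by rewrite size_map.
  by have [_] := uniq_min_size um sub sz.
pose RK s := [seq r <- iota 0 (a + b) | nth false W r == s].
have SLE s : perm_eq (start_levels a b P s) [seq absz (f r) | r <- RK s].
  rewrite /start_levels sP /RK; apply: perm_trans (perm_map _ (perm_filter _ rperm)).
  rewrite filter_map -map_comp.
  set l := (X in perm_eq X _); set l' := (X in perm_eq _ X).
  have -> // : l = l'.
  rewrite /l /l'; have -> : [seq i <- iota 0 (a + b) | nth false P i == s]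
     = [seq i <- iota 0 (a + b) | preim rho (fun r => nth false W r == s) i].
    by apply: eq_in_filter => i; rewrite mem_iota add0n /= => /stp->.
  apply/eq_in_map => i; rewrite mem_filter mem_iota add0n => /and3P[_ _ iP] /=.
  by rewrite -slE.
have f0 r : r < (a + b) -> (0 <= f r)%R.
  move=> rn; have : r \in map rho (iota 0 (a + b)) by rewrite (perm_mem rperm) mem_iota.
  by case/mapP => i; rewrite mem_iota add0n => iP ->; rewrite -slE.
have cW : count_mem true W = a.
  rewrite -count_positions sW -size_filter -/(RK true) -(size_map (absz \o f)).
  rewrite -(perm_size (SLE true)) size_map size_filter.
  by have := count_positions P true; rewrite (dw_norths dw).
apply: bounding_path_easts => // y ya; rewrite lambda_sweep //.
have -> : sort geq [seq count (ltn^~ s) (start_levels a b P false) | s <- start_levels a b P true]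
   = rev [seq easts_before W y | y <- iota 0 a].
  apply: (@sorted_eq _ geq); first exact: rev_trans leq_trans.
  - by move=> m p; rewrite andbC => /anti_leq.
  - by apply: sort_sorted => m p; apply: leq_total.
  - rewrite rev_sorted sorted_map; apply: (sub_sorted _ (iota_sorted 0 a)) => m p.
    exact: easts_before_homo.
  rewrite perm_sym perm_rev perm_sym (permPl (permEl (perm_sort _ _))).
  apply: perm_trans (perm_map _ (SLE true)) _; rewrite -map_comp.
  (* The norths of [W] have ranks [y + easts_before W y]. *)
  have NRK : perm_eq (RK true) [seq y + easts_before W y | y <- iota 0 a].
    apply: uniq_perm; first by rewrite filter_uniq ?iota_uniq.
      rewrite map_inj_in_uniq ?iota_uniq // => m p; rewrite !mem_iota !add0n => /andP[_ ma] /andP[_ pa] e.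
      have := point_north (_ : m < count_mem true W); rewrite cW => /(_ ma).
      by rewrite e point_north ?cW // => -[_ ->].
    move=> r; rewrite mem_filter eqb_id mem_iota add0n leq0n /=; case: (ltnP r (a + b)) => rn.
      by rewrite andbT nth_north ?sW // -cW.
    rewrite andbF; apply/esym/negbTE/mapP => -[m]; rewrite mem_iota add0n => /andP[_ ma] e.
    move: rn; rewrite e leqNgt -sW size_word => /negP[]; rewrite -addSn leq_add ?cW //.
    exact: easts_before_le.
  apply: perm_trans (perm_map _ NRK) _; rewrite -map_comp.
  set l := (X in perm_eq X _); set l' := (X in perm_eq _ X); have -> // : l = l'.
  apply/eq_in_map => m; rewrite mem_iota add0n => /andP[_ ma] /=.
  set r := m + _; have rn : r < (a + b).
    by rewrite -sW size_word /r -addSn leq_add ?cW ?easts_before_le.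
  have -> : easts_before W m = (point W r).1 by rewrite point_north ?cW.
  rewrite (permP (SLE false)) count_map count_filter easts_count ?sW ?(ltnW rn) //.
  rewrite -{1}(subnKC (ltnW rn)) iotaD count_cat -[RHS]addn0; congr (_ + _).
    apply: eq_in_count => q; rewrite mem_iota add0n => /andP[_ qr] /=.
    have qn := ltn_trans qr rn.
    have h : (f q < f r)%R by rewrite (increasing_lt inc qn rn).
    have h' : absz (f q) < absz (f r) by have := f0 _ qn; have := f0 _ rn; lia.
    by rewrite h'.
  apply/eqP; rewrite -leqn0 leqNgt -has_count; apply/hasPn => q.
  rewrite mem_iota subnKC ?(ltnW rn) // => /andP[rq qn] /=.
  have h : (f r <= f q)%R by rewrite leNgt (increasing_lt inc qn rn) -leqNgt.
  have h' : absz (f r) <= absz (f q) by have := f0 _ qn; have := f0 _ rn; lia.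
  by rewrite ltnNge h'.
rewrite nth_rev ?size_map ?size_iota; last by lia.
by rewrite (nth_map 0) ?size_iota ?nth_iota; try lia; congr easts_before; lia.
Qed.

(** * Paths given by the ranks of their levels *)

Definition rise (a b : nat) (s : bool) : int := (if s then b%:Z else - a%:Z)%R.

(** A path whose steps are known only through the order of their levels.  The
    vertices are numbered by increasing level, [f r] being the level of the one
    of rank [r]; [W] lists the steps by the rank of their start, [W'] lists them
    by the rank of their end, and the step that starts at rank [r] ends at rank
    [p r].  The defect [g] concerns the step that ends at rank 0: it ends [g]
    below level 0.  A closed path has [g = 0]; a positive defect leaves room
    for one more block of steps below, see [ranking_glue]. *)
Record ranking (a b : nat) (g : int) (W W' : seq bool) (f : nat -> int) (p : nat -> nat) : Prop :=
  Ranking {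
    ranking0 : f 0 = 0%R;
    ranking_lt : forall r, r.+1 < size W -> (f r < f r.+1)%R;
    ranking_size : size W' = size W;
    ranking_bound : forall r, r < size W -> p r < size W;
    ranking_step : forall r, r < size W -> nth false W' (p r) = nth false W r;
    ranking_level : forall r, r < size W ->
      f (p r) = (f r + rise a b (nth false W r) + (if p r == 0%N then g else 0))%R }.

Definition orbit_word (W : seq bool) (p : nat -> nat) (k m : nat) : seq bool :=
  mkseq (fun i => nth false W (iter (k + i) p 0)) m.

Lemma level_step a b w i : i < size w ->
  level a b (point w i.+1) = (level a b (point w i) + rise a b (nth false w i))%R.
Proof.
by move=> iw; rewrite point_step // /level /rise /=; case: (nth _ _ _) => /=; lia.
Qed.

Lemma level_rev a b w i : i <= size w -> level a b (point (rev w) i)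
  = (level a b (point w (size w)) - level a b (point w (size w - i)))%R.
Proof.
move=> iw; rewrite /level /point /= take_size take_rev !count_rev.
have c s := congr1 (count_mem s) (cat_take_drop (size w - i) w).
have := c true; have := c false; rewrite !count_cat => <- <-.
by rewrite !mulnDr !PoszD; ring.
Qed.

Section orbit.
Variables (a b : nat) (W W' : seq bool) (f : nat -> int) (p : nat -> nat).
Hypotheses (a0 : 0 < a) (b0 : 0 < b) (hab : coprime a b).
Hypotheses (cN : count_mem true W = a) (cE : count_mem false W = b).
Hypothesis rk : ranking a b 0 W W' f p.

Let rho i := iter i p 0.

Lemma orbit_size : size W = a + b.
Proof. by rewrite size_word cN cE. Qed.

Lemma orbit_lt i : rho i < a + b.
Proof.
elim: i => [|i IH] /=; first by rewrite addn_gt0 a0.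
by rewrite -orbit_size; apply: (ranking_bound rk); rewrite orbit_size.
Qed.

Lemma orbit_level k m i : i <= m ->
  level a b (point (orbit_word W p k m) i) = (f (rho (k + i)) - f (rho k))%R.
Proof.
elim: i => [|i IH] im; first by rewrite addn0 subrr /point take0 levelE !muln0.
have iw : i < size (orbit_word W p k m) by rewrite size_mkseq.
rewrite level_step // IH 1?ltnW // nth_mkseq // addnS.
have /(ranking_level rk) : rho (k + i) < size W by rewrite orbit_size orbit_lt.
by rewrite /rho /= => ->; case: ifP; lia.
Qed.

(** A closed piece of the walk of length [i] has as many norths and easts as some
    multiple of [(b, a)], hence is not shorter than [a + b].  So the walk visits
    every rank before it comes back. *)
Lemma orbit_free k i : 0 < i < a + b -> rho (k + i) <> rho k.
Proof.
move=> /andP[i0 iab] e; set w := orbit_word W p k i.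
have sw : size w = i by rewrite size_mkseq.
have := @orbit_level k i i (leqnn i).
rewrite e subrr -/w /point take_oversize ?sw // levelE => h.
have := size_word w; rewrite sw.
move: (count_mem true w) (count_mem false w) h => y x h xy.
have e' : b * y = a * x by lia.
have bx : b %| x by rewrite -(@Gauss_dvdr _ a) 1?coprime_sym // -e' dvdn_mulr.
have ay : a %| y by rewrite -(@Gauss_dvdr _ b) // e' dvdn_mulr.
case: (posnP x) => x0.
  by move/eqP: e'; rewrite x0 muln0 muln_eq0; lia.
case: (posnP y) => y0.
  by move/eqP: e'; rewrite y0 muln0 eq_sym muln_eq0; lia.
by have := dvdn_leq x0 bx; have := dvdn_leq y0 ay; lia.
Qed.

Lemma orbit_perm : perm_eq (map rho (iota 0 (a + b))) (iota 0 (a + b)).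
Proof.
have um : uniq (map rho (iota 0 (a + b))).
  rewrite map_inj_in_uniq ?iota_uniq // => i j; rewrite !mem_iota !add0n => /andP[_ ip] /andP[_ jp] e.
  case: (ltngtP i j) => // ij.
    by case: (@orbit_free i (j - i)); [lia | rewrite subnKC // ltnW].
  by case: (@orbit_free j (i - j)); [lia | rewrite subnKC // ltnW].
apply: uniq_perm; rewrite ?iota_uniq //.
have sub : {subset map rho (iota 0 (a + b)) <= iota 0 (a + b)}.
  by move=> _ /mapP[i _ ->]; rewrite mem_iota add0n; apply: orbit_lt.
have sz : size (iota 0 (a + b)) <= size (map rho (iota 0 (a + b))) by rewrite size_map.
by have [_] := uniq_min_size um sub sz.
Qed.

Lemma orbit_surj r : r < a + b -> exists2 i, i < a + b & rho i = r.
Proof.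
move=> rn; have : r \in map rho (iota 0 (a + b)) by rewrite (perm_mem orbit_perm) mem_iota.
by case/mapP => i; rewrite mem_iota add0n => /andP[_ ip] ->; exists i.
Qed.

Definition orbit_path : lpath a b := [tuple nth false W (iter i p 0) | i < a + b].

Lemma orbit_pathE : orbit_path = orbit_word W p 0 (a + b) :> seq bool.
Proof.
apply: (@eq_from_nth _ false); first by rewrite size_tuple size_mkseq.
move=> i; rewrite size_tuple => iab.
have -> : nth false orbit_path i = tnth orbit_path (Ordinal iab) by rewrite (tnth_nth false).
by rewrite tnth_mktuple nth_mkseq.
Qed.

Lemma orbit_north : count_mem true orbit_path = a.
Proof.
rewrite orbit_pathE /orbit_word /mkseq.
rewrite (_ : map _ _ = map (nth false W) (map rho (iota 0 (a + b)))); last by rewrite -map_comp.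
by rewrite (permP (perm_map _ orbit_perm)) -orbit_size -/(mkseq _ _) mkseq_nth.
Qed.

Lemma rank_lt r s : r < a + b -> s < a + b -> (f r < f s)%R = (r < s).
Proof. by apply: increasing_lt => t; rewrite -orbit_size; exact: (ranking_lt rk). Qed.

Lemma rank_le r s : r < a + b -> s < a + b -> (f r <= f s)%R = (r <= s).
Proof. by move=> rn sn; rewrite leNgt rank_lt // -leqNgt. Qed.

Lemma orbit_dyck : orbit_path \in dyck a b.
Proof.
rewrite inE orbit_north eqxx; apply/allP => i; rewrite mem_iota => /andP[_ iab].
rewrite orbit_pathE orbit_level; last by lia.
by rewrite subr_ge0 rank_le ?orbit_lt.
Qed.

Lemma orbit_zeta : zeta orbit_path = W :> seq bool.
Proof.
apply: (@zeta_sorts_levels a b _ W f rho) => //; try exact: orbit_dyck; try exact: orbit_size.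
- by move=> r rn; rewrite rank_lt // ltnW.
- by move=> i _; apply: orbit_lt.
- by move=> i iab; rewrite orbit_pathE orbit_level ?(ltnW iab) // (ranking0 rk) subr0.
by move=> i iab; rewrite orbit_pathE nth_mkseq.
Qed.

Lemma orbit_period i : rho (i + (a + b)) = rho i.
Proof.
have sE : size orbit_path = a + b by rewrite size_tuple.
have : rho (a + b) = 0.
  have := @orbit_level 0 (a + b) (a + b) (leqnn _).
  rewrite -orbit_pathE /point take_oversize ?sE // orbit_north levelE.
  have : count_mem false orbit_path = b by have := size_word orbit_path; rewrite sE orbit_north; lia.
  move=> ->; rewrite mulnC subrr (ranking0 rk) subr0 => e.
  apply/eqP; rewrite -leqn0 -rank_le ?orbit_lt ?addn_gt0 ?a0 //.
  by rewrite (ranking0 rk) -e.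
by move=> e; rewrite /rho (iterD i (a + b)) [iter (a + b) _ _]e.
Qed.

Lemma orbit_rot k : k <= a + b -> rot k orbit_path = orbit_word W p k (a + b).
Proof.
move=> kab; apply: (@eq_from_nth _ false); first by rewrite size_rot size_tuple size_mkseq.
move=> i; rewrite size_rot size_tuple => iab; rewrite nth_mkseq //.
rewrite /rot nth_cat size_drop size_tuple nth_drop orbit_pathE; case: ltnP => h.
  by rewrite nth_mkseq //; lia.
rewrite nth_take; last by lia.
rewrite nth_mkseq; last by lia.
rewrite add0n -/(rho _) -/(rho (k + i)) -orbit_period; congr (nth _ _ (rho _)); lia.
Qed.

(** Cutting the closed path at its highest vertex, and there only, gives a path
    strictly below the diagonal. *)
Lemma orbit_conjugate : exists k, [/\ k < a + b, rho k = (a + b).-1 &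
   conjugate orbit_path = rev (orbit_word W p k (a + b)) :> seq bool].
Proof.
have n0 : 0 < a + b by rewrite addn_gt0 a0.
have top k : k < a + b -> strictly_below a b (rot k orbit_path) = (rho k == (a + b).-1).
  move=> kab; rewrite orbit_rot ?(ltnW kab) //; apply/allP/eqP => [h|kt i]; last first.
    rewrite mem_iota => ip; rewrite orbit_level; last by lia.
    rewrite subr_lt0 rank_lt ?orbit_lt // ltn_neqAle; apply/andP; split; last first.
      by have := orbit_lt (k + i); rewrite kt; lia.
    by apply/eqP; apply: orbit_free; lia.
  have [j jn jt] : exists2 j, j < a + b & rho j = (a + b).-1 by apply: orbit_surj; lia.
  case: (j =P k) => [<-//|jk].
  have [i ip ji] : exists2 i, 0 < i < a + b & rho (k + i) = (a + b).-1.
    case: (ltnP k j) => kj; first by exists (j - k); [lia | rewrite subnKC // ltnW].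
    exists (j + (a + b) - k); first by lia.
    by rewrite subnKC ?orbit_period //; lia.
  have := h i; rewrite mem_iota orbit_level; last by lia.
  rewrite ji subr_lt0 rank_lt ?orbit_lt //; last by lia.
  have ii : 1 <= i < 1 + (a + b).-1 by lia.
  by move=> /(_ ii); have := orbit_lt k; lia.
have [j jn jt] : exists2 j, j < a + b & rho j = (a + b).-1 by apply: orbit_surj; lia.
pose k := find (fun i => strictly_below a b (rot i orbit_path)) (iota 0 (a + b)).
have hk : has (fun i => strictly_below a b (rot i orbit_path)) (iota 0 (a + b)).
  by apply/hasP; exists j; rewrite ?mem_iota // top // jt.
have kn : k < a + b by have := hk; rewrite has_find size_iota.
exists k; split=> //.
  by have := nth_find 0 hk; rewrite -/k nth_iota // top // => /eqP.
by rewrite -orbit_rot ?(ltnW kn).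
Qed.

(** Rotation by 180 degrees exchanges starts and ends and replaces each level by
    its distance to the highest level.  The zeta map thus lists the steps of the
    conjugate by decreasing end level in the original path. *)
Lemma orbit_conjugate_zeta : zeta (conjugate orbit_path) = rev W' :> seq bool.
Proof.
have [k [kn kt cE']] := orbit_conjugate.
have szw : size (orbit_word W p k (a + b)) = a + b by rewrite size_mkseq.
have lvE i : i <= a + b -> level a b (point (conjugate orbit_path) i)
    = (f (a + b).-1 - f (rho (k + (a + b - i))))%R.
  move=> iab; rewrite cE' level_rev szw // !orbit_level //; last by lia.
  by rewrite orbit_period kt; lia.
have nE : count_mem true (conjugate orbit_path) = a.
  rewrite cE' count_rev -orbit_rot ?(ltnW kn) // -[RHS]orbit_north.
  by apply/permP; rewrite perm_rot.
apply: (@zeta_sorts_levels a b _ (rev W') (fun r => f (a + b).-1 - f ((a + b).-1 - r)%N)%R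
   (fun i => (a + b).-1 - rho (k + (a + b - i)))) => //.
- rewrite inE nE eqxx; apply/allP => i; rewrite mem_iota => /andP[_ iab].
  rewrite lvE; last by lia.
  rewrite subr_ge0 rank_le ?orbit_lt //; last by lia.
  by have := orbit_lt (k + (a + b - i)); lia.
- by rewrite size_rev (ranking_size rk) orbit_size.
- by move=> r rn; rewrite ltrD2l ltrN2 rank_lt; lia.
- by move=> i iab; lia.
- move=> i iab; rewrite lvE ?(ltnW iab) //; congr (_ - f _)%R.
  by have := orbit_lt (k + (a + b - i)); lia.
move=> i iab; rewrite cE' nth_rev ?szw // nth_mkseq; last by lia.
have h := orbit_lt (k + (a + b - i)).
rewrite nth_rev (ranking_size rk) orbit_size; last by lia.
have -> : a + b - ((a + b).-1 - rho (k + (a + b - i))).+1 = rho (k + (a + b - i)) by lia.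
have -> : k + (a + b - i) = (k + (a + b - i.+1)).+1 by lia.
by rewrite [RHS](ranking_step rk) // orbit_size orbit_lt.
Qed.
End orbit.

(** * Levels of a single block *)

(** The next lemmas describe the sequence of integer parts of
    [t * (x0 + y0) / (c + d)], where [(x0, y0)] is a Bezout vector of [(d, c)].
    Modulo [c + d], the number [x0 + y0] is the inverse of [d] and the opposite of
    the inverse of [c], so that a shift of [t] by [c] or [d] changes
    [t * (x0 + y0)] by [- 1] or [1], respectively; this affects the integer part
    only next to a multiple of [c + d]. *)
Lemma beatty_dvd c d x0 y0 t : d * y0 = (c * x0).+1 ->
  (c + d %| t * (x0 + y0)) -> c + d %| t.
Proof.
move=> bez /(dvdn_mull d); rewrite mulnCA.
have -> : d * (x0 + y0) = 1 + (c + d) * x0 by lia.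
by rewrite mulnDr muln1 mulnCA dvdn_addl // dvdn_mulr.
Qed.

Lemma beatty_addr c d x0 y0 t : 0 < d -> d * y0 = (c * x0).+1 -> t < c ->
  (t + d) * (x0 + y0) %/ (c + d) = x0 + t * (x0 + y0) %/ (c + d).
Proof.
move=> d0 bez tc; have n0 : 0 < c + d by lia.
have -> : (t + d) * (x0 + y0) = x0 * (c + d) + (t * (x0 + y0)).+1 by lia.
rewrite divnMDl // -[(t * _).+1]addn1.
have ndvd : ~~ (c + d %| (t * (x0 + y0)).+1).
  apply/negP => h; have /(beatty_dvd bez) : c + d %| (t + d) * (x0 + y0).
    have -> : (t + d) * (x0 + y0) = x0 * (c + d) + (t * (x0 + y0)).+1 by lia.
    by rewrite dvdn_addr // dvdn_mull.
  by move/dvdn_leq; lia.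
by rewrite addn1 divnS // (negbTE ndvd) add0n.
Qed.

Lemma beatty_addl c d x0 y0 t : 0 < c -> d * y0 = (c * x0).+1 -> 0 < t <= d ->
  (t + c) * (x0 + y0) %/ (c + d) = y0 + t * (x0 + y0) %/ (c + d).
Proof.
move=> c0 bez td; have n0 : 0 < c + d by lia.
have tn : ~~ (c + d %| t * (x0 + y0)).
  by apply/negP => /(beatty_dvd bez)/dvdn_leq; lia.
have y1 : 0 < y0 by case: (y0) bez => //; lia.
have tp : 0 < t * (x0 + y0) by rewrite muln_gt0; lia.
have -> : (t + c) * (x0 + y0) = y0 * (c + d) + (t * (x0 + y0)).-1 by lia.
rewrite divnMDl //; congr (_ + _).
by rewrite -[in RHS](prednK tp) divnS // (prednK tp) (negbTE tn) add0n.
Qed.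

Lemma beatty_c c d x0 y0 : 0 < c -> d * y0 = (c * x0).+1 ->
  c * (x0 + y0) %/ (c + d) = y0.-1.
Proof.
move=> c0 bez; case: y0 bez => [|y0] bez; first by lia.
have -> : c * (x0 + y0.+1) = y0 * (c + d) + (c + d).-1 by lia.
by rewrite divnMDl ?divn_small ?addn0 //; lia.
Qed.

(** The levels of the vertices of one block, by rank.  Consider the lattice path
    of [c] norths and [d] easts that stays closest to the segment of slope
    [c / d]; when a north counts for [d] and an east for [- c], its levels are
    [0, ..., c + d - 1], each taken once.  If [(x0, y0)] is the vertex of level 1,
    the one of level [t] is [t * (x0, y0)] minus [m t] times [(d, c)], where
    [m t] is the integer part of [t * (x0 + y0) / (c + d)].  Let now a north count
    for [b] and an east for [- a], so that [(x0, y0)] has level [l] and [(d, c)]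
    has level [g1 - g0], and lower by [g1] the highest vertex and all
    those that follow it, which are those with [m (t + 1) = m t + 1].  The level
    of rank [t] becomes [t * l + g0 * m t - g1 * m (t + 1)]. *)
Definition block_level (c d x0 y0 : nat) (l g0 g1 : int) (t : nat) : int :=
  (t%:Z * l + g0 * (t * (x0 + y0) %/ (c + d))%:Z
    - g1 * (t.+1 * (x0 + y0) %/ (c + d))%:Z)%R.

Lemma block_level0 c d x0 y0 l g0 g1 : x0 < d -> y0 <= c ->
  block_level c d x0 y0 l g0 g1 0 = 0%R.
Proof. by move=> xd yc; rewrite /block_level !mul0n div0n mul1n divn_small ?mulr0 //; lia. Qed.

(** The increments of the integer parts are 0 or 1, so each level exceeds the
    preceding one by at least [l - g1]. *)
Lemma block_level_lt c d x0 y0 l g0 g1 t : x0 < d -> y0 <= c ->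
  (0 <= g0)%R -> (0 <= g1)%R -> (g1 < l)%R ->
  (block_level c d x0 y0 l g0 g1 t < block_level c d x0 y0 l g0 g1 t.+1)%R.
Proof.
move=> xd yc g00 g10 gl; rewrite /block_level.
have := leq_divDl (c + d) (t.+1 * (x0 + y0)) (x0 + y0).
have -> : t.+1 * (x0 + y0) + (x0 + y0) = t.+2 * (x0 + y0) by lia.
rewrite (divn_small (_ : x0 + y0 < c + d)); last by lia.
rewrite addn0.
have /(leq_div2r (c + d)) : t * (x0 + y0) <= t.+1 * (x0 + y0) by rewrite leq_mul2r leqnSn orbT.
move: (_ %/ _) (_ %/ _) (_ %/ _) => m3 m2 m1 h1 h2.
have : (g1 * m3%:Z <= g1 * (m2%:Z + 1))%R by apply: ler_wpM2l => //; lia.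
have : (g0 * m1%:Z <= g0 * m2%:Z)%R by apply: ler_wpM2l => //; lia.
lia.
Qed.

(** North steps of the block shift the rank by [d]; the one that reaches the
    highest vertex is [g1] too high. *)
Lemma block_level_north a b c d x0 y0 g0 g1 t :
  let l := ((b * y0)%:Z - (a * x0)%:Z)%R in
  let f := block_level c d x0 y0 l g0 g1 in
  0 < c -> 0 < d -> d * y0 = (c * x0).+1 ->
  (g1 = g0 + (b * c)%:Z - (a * d)%:Z)%R ->
  t < c -> f (t + d)%N = (f t + b%:Z - (if t.+1 == c then g1 else 0))%R.
Proof.
move=> l f c0 d0 bez gE tc; rewrite /f /block_level beatty_addr // -addSn.
(* [d * (x0, y0)] and [x0 * (d, c)] differ by a unit north step. *)
have e1 : (d%:Z * l - (g1 - g0) * x0%:Z = b%:Z)%R.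
  have : (d%:Z * y0%:Z = c%:Z * x0%:Z + 1)%R by lia.
  by rewrite gE /l => h; have -> : (b%:Z = b%:Z * (d%:Z * y0%:Z - c%:Z * x0%:Z))%R; [rewrite h; ring | lia].
case: eqP => [e|ne].
  rewrite e beatty_c //.
  have -> : (c + d) * (x0 + y0) %/ (c + d) = x0 + y0 by rewrite mulKn //; lia.
  have y1 : 0 < y0 by case: (y0) bez => //; lia.
  move: (_ %/ _) e1 => m; case: (y0) y1 => // y1 _ /=; lia.
rewrite beatty_addr //; last by lia.
move: (_ %/ _) (_ %/ _) e1 => m1 m2; lia.
Qed.

(** East steps of the block shift the rank by [- c]; the one that reaches the
    lowest vertex is [g0] too low. *)
Lemma block_level_east a b c d x0 y0 g0 g1 t :
  let l := ((b * y0)%:Z - (a * x0)%:Z)%R in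
  let f := block_level c d x0 y0 l g0 g1 in
  0 < c -> 0 < d -> d * y0 = (c * x0).+1 ->
  (g1 = g0 + (b * c)%:Z - (a * d)%:Z)%R ->
  t < d -> f t = (f (t + c)%N - a%:Z + (if t == 0%N then g0 else 0))%R.
Proof.
move=> l f c0 d0 bez gE td; rewrite /f /block_level -addSn.
rewrite (@beatty_addl _ _ _ _ t.+1) //.
(* [y0 * (d, c)] and [c * (x0, y0)] differ by a unit east step. *)
have e1 : (c%:Z * l - (g1 - g0) * y0%:Z = a%:Z)%R.
  have : (d%:Z * y0%:Z = c%:Z * x0%:Z + 1)%R by lia.
  by rewrite gE /l => h; have -> : (a%:Z = a%:Z * (d%:Z * y0%:Z - c%:Z * x0%:Z))%R; [rewrite h; ring | lia].
case: eqP => [->|ne].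
  rewrite add0n beatty_c // mul0n div0n.
  have y1 : 0 < y0 by case: (y0) bez => //; lia.
  move: (_ %/ _) e1 => m; case: (y0) y1 => // y1 _ /=; lia.
rewrite beatty_addl //; last by lia.
move: (_ %/ _) (_ %/ _) e1 => m1 m2; lia.
Qed.

(** * Rankings of one block and of a chain of blocks *)

Lemma nth_block c d r : r < c + d ->
  nth false (nseq c true ++ nseq d false) r = (r < c).
Proof. by move=> rn; rewrite nth_cat size_nseq !nth_nseq; case: ltnP => // cr; case: ifP. Qed.

Lemma ranking_block (a b c d x0 y0 : nat) (g0 : int) :
  0 < c -> 0 < d -> d * y0 = (c * x0).+1 -> x0 < d -> y0 <= c ->
  (0 <= g0)%R -> (0 < (b * y0)%:Z - (a * x0)%:Z)%R ->
  (g0 + (b * c)%:Z - (a * d)%:Z = 0)%R ->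
  exists f p, ranking a b g0 (nseq c true ++ nseq d false)
                             (nseq d false ++ nseq c true) f p.
Proof.
move=> c0 d0 bez xd yc g00 gl gE.
pose f := block_level c d x0 y0 ((b * y0)%:Z - (a * x0)%:Z)%R g0 0.
pose p r := if r < c then r + d else r - c.
exists f, p; split; rewrite ?size_cat ?size_nseq; try (by rewrite addnC).
- exact: block_level0.
- by move=> r _; apply: block_level_lt.
- by move=> r rn; rewrite /p; case: (ltnP r c) => rc; lia.
- move=> r rn; rewrite nth_block // /p nth_cat size_nseq !nth_nseq; case: (ltnP r c) => rc.
    by rewrite ifN ?addnK ?rc //; lia.
  by rewrite (_ : r - c < d) //; lia.
move=> r rn; rewrite nth_block // /p; case: (ltnP r c) => rc.
  have := block_level_north c0 d0 bez (esym gE) rc; rewrite /f => ->.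
  rewrite (_ : (r + d == 0) = false); last by lia.
  by rewrite /rise; case: eqP; lia.
have rd : r - c < d by lia.
have := block_level_east c0 d0 bez (esym gE) rd; rewrite /f => ->.
by rewrite subnK // /rise.
Qed.

(** A block followed by the ranks of [V], with exchanged ends: the north step that
    should reach the highest vertex of the block ends at the lowest vertex of
    [V], and the east step of [V] that should reach the latter ends at the
    highest vertex of the block.  Both defects are [g1], which is also the gap put
    between these two vertices, so all steps have their right length.  In the
    list of steps by end, the exchange turns north-east at the junction into
    east-north. *)
Lemma ranking_glue (a b c d x0 y0 : nat) (g0 g1 : int) V V' h q :
  0 < c -> 0 < d -> d * y0 = (c * x0).+1 -> x0 < d -> y0 <= c ->
  (0 <= g0)%R -> (0 < g1)%R -> (g1 < (b * y0)%:Z - (a * x0)%:Z)%R ->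
  (g1 = g0 + (b * c)%:Z - (a * d)%:Z)%R ->
  ranking a b g1 V (false :: V') h q ->
  exists f p, ranking a b g0 (nseq c true ++ nseq d false ++ V)
     (nseq d false ++ nseq c.-1 true ++ [:: false, true & V']) f p.
Proof.
move=> c0 d0 bez xd yc g00 g10 gl gE [h0 hlt hsz hq hst hlv].
pose n := c + d.
pose fb := block_level c d x0 y0 ((b * y0)%:Z - (a * x0)%:Z)%R g0 g1.
pose f r := if r < n then fb r else (fb n.-1 + g1 + h (r - n)%N)%R.
pose p r := if r < c then (if r.+1 == c then n else r + d)
            else if r < n then r - c
            else if q (r - n) == 0 then n.-1 else n + q (r - n).
have V0 : 0 < size V by rewrite -hsz.
have WE r : nth false (nseq c true ++ nseq d false ++ V) r =
   if r < n then r < c else nth false V (r - n).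
  rewrite catA nth_cat size_cat !size_nseq -/n; case: ifP => // rn.
  by rewrite nth_block.
have W'E r : nth false (nseq d false ++ nseq c.-1 true ++ [:: false, true & V']) r =
   if r < d then false else if r < n.-1 then true else
   if r == n.-1 then false else if r == n then true else nth false V' (r - n.+1).
  rewrite nth_cat size_nseq nth_nseq; case: ltnP => // rd.
  rewrite nth_cat size_nseq nth_nseq (_ : (r - d < c.-1) = (r < n.-1)); last by lia.
  case: ltnP => // rn; rewrite -subnDA (_ : d + c.-1 = n.-1); last by lia.
  case: eqP => [->|ne]; first by rewrite subnn.
  rewrite (_ : r - n.-1 = (r - n).+1); last by lia.
  case: eqP => [->|ne2] /=; first by rewrite subnn.
  by rewrite (_ : r - n = (r - n.+1).+1) //; lia.
exists f, p; split; rewrite ?size_cat ?size_nseq.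
- by rewrite /f (_ : 0 < n) ?addn_gt0 ?c0 //; apply: block_level0.
- move=> r rn; rewrite /f; case: (ltngtP r.+1 n) => rn' /=.
  + by apply: block_level_lt => //; lia.
  + rewrite subSn // -?addrA ?ltrD2l //; apply: hlt; lia.
  + by rewrite -rn' subnn h0 addr0 /=; lia.
- by rewrite /= -hsz /=; lia.
- move=> r rn; rewrite /p; case: (ltnP r c) => rc; first by case: (r.+1 =P c); lia.
  case: (ltnP r n) => rn'; first by lia.
  by case: (q _ =P 0) => _; [lia | have := hq (r - n); lia].
- move=> r rn; rewrite WE /p; case: (ltnP r c) => rc.
    rewrite (_ : r < n); last by lia.
    case: (r.+1 =P c) => rc1; rewrite W'E.
      by do !case: ifP; lia.
    by do !case: ifP; lia.
  case: (ltnP r n) => rn'; first by rewrite W'E ifT //; lia.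
  have rV : r - n < size V by lia.
  rewrite -(hst _ rV); case: (q _ =P 0) => [->|q0].
    by rewrite W'E /=; do !case: ifP; lia.
  case: (q _) q0 => // m _; rewrite W'E /= (_ : n + m.+1 - n.+1 = m); last by lia.
  by do !case: ifP; lia.
move=> r rn; rewrite WE /p; case: (ltnP r c) => rc.
  have -> : r < n by lia.
  have := block_level_north c0 d0 bez gE rc; rewrite -/fb => E.
  case: eqP => rc1.
    have -> : (n == 0) = false by lia.
    have rn' : r < n by lia.
    rewrite /f ltnn subnn h0 rn' (_ : n.-1 = r + d); last by lia.
    by rewrite E rc1 eqxx /rise; lia.
  have -> : (r + d == 0) = false by lia.
  have rn' : r < n by lia.
  have rdn : r + d < n by lia.
  by rewrite /f rn' rdn E /rise; case: eqP; lia.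
case: (ltnP r n) => rn'.
  have rcn : r - c < n by lia.
  rewrite /f rcn rn'.
  have rd : r - c < d by lia.
  have := block_level_east c0 d0 bez gE rd; rewrite -/fb subnK // => ->.
have rV : r - n < size V by lia.
have nr : (r < n) = false by lia.
have := hlv _ rV; case: (q _ =P 0) => [q0|q0] E; rewrite /f nr.
  rewrite (_ : (n.-1 == 0) = false); last by lia.
  rewrite (_ : n.-1 < n); last by lia.
  by move: E; rewrite q0 h0; lia.
have nq m : (n + m < n) = false by lia.
rewrite nq addKn E (_ : (n + _ == 0) = false) //; last by lia.
by rewrite addr0 !addrA addr0.
Qed.

(** * The ranking of a valley path *)

Lemma valleyP w z : reflect
  (exists2 i, 0 < i < size w & [/\ nth true w i.-1 = false, nth false w i & z = point w i])
  (valley w z).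
Proof.
apply: (iffP hasP) => [[i _ /and3P[h1 h2 /eqP->]]|[[//|i] iw [/= h1 h2 ->]]].
  exists i.+1; last by rewrite (negbTE h1).
  by move: h2; case: (ltnP i.+1 (size w)) => // h; rewrite nth_default.
by exists i; rewrite ?h1 ?h2 ?eqxx // mem_iota; lia.
Qed.

Lemma valley_cat U V : valley (rcons U false ++ true :: V) (count_mem false (rcons U false), count_mem true U).
Proof.
apply/valleyP; exists (size U).+1; first by rewrite size_cat size_rcons /=; lia.
rewrite /= nth_cat size_rcons ltnSn nth_rcons ltnn eqxx.
rewrite nth_cat size_rcons ltnn subnn; split=> //.
rewrite /point take_size_cat ?size_rcons //; congr pair.
by rewrite -cats1 count_cat /= !addn0.
Qed.

Lemma valley_x_gt0 w x y : valley w (x, y) -> 0 < x.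
Proof.
case/valleyP => -[//|i] iw [/= h1 _ [-> _]].
by rewrite (take_nth true (ltnW iw)) h1 -cats1 count_cat addn_gt0 orbT.
Qed.

Lemma valley_at Q U V U' : Q = U ++ true :: V -> U = rcons U' false ->
  valley Q (count_mem false U, count_mem true U).
Proof.
move=> -> ->; have -> : count_mem true (rcons U' false) = count_mem true U'.
  by rewrite -cats1 count_cat addn0.
exact: valley_cat.
Qed.

Lemma point_before_run U c R i :
  (point (U ++ nseq c true ++ R) i).2 < count_mem true U + c ->
  (point (U ++ nseq c true ++ R) i).1 <= count_mem false U.
Proof.
rewrite catA; set w := _ ++ R; set T := U ++ nseq c true.
have tT : take (size T) w = T by rewrite take_size_cat.
have cT : count_mem true T = count_mem true U + c.
  by rewrite count_cat count_nseq mul1n.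
have cF : count_mem false T = count_mem false U.
  by rewrite count_cat count_nseq addn0.
rewrite /point /=; case: (leqP i (size T)) => [h _|/ltnW h].
  by rewrite -cF -[in leqRHS]tT count_take_le.
by rewrite -cT -[in ltnRHS]tT ltnNge count_take_le.
Qed.

(** Along a run of norths followed by a run of easts there is no valley before
    the end of the second run. *)
Lemma valley_after_block U c d R zx zy :
  valley (U ++ nseq c true ++ nseq d false ++ R) (zx, zy) ->
  count_mem true U < zy ->
  [/\ 0 < size R, count_mem false U + d <= zx & count_mem true U + c <= zy].
Proof.
set w := _ ++ _; case/valleyP => i iw [h1 h2 [-> ->]] h3.
pose T := U ++ nseq c true ++ nseq d false.
have wT : w = T ++ R by rewrite /T -!catA.
have sT : size T = size U + (c + d) by rewrite !size_cat !size_nseq.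
have iU : size U < i.
  rewrite ltnNge; apply/negP => /(count_take_le true w).
  have -> : take (size U) w = U by rewrite take_size_cat.
  by move=> h; have := leq_trans h3 h; rewrite ltnn.
have iT : size T <= i.
  move: h1 h2; rewrite /w !nth_cat !size_nseq !nth_nseq sT.
  by do !case: ifP => //; lia.
split.
- by have sw : size w = size T + size R; [rewrite wT size_cat | lia].
- have := count_take_le false w iT.
  have -> : take (size T) w = T by rewrite wT take_size_cat.
  by rewrite !count_cat !count_nseq /=; lia.
have := count_take_le true w iT.
have -> : take (size T) w = T by rewrite wT take_size_cat.
by rewrite !count_cat !count_nseq /=; lia.
Qed.

Lemma run_split (s : bool) w : exists n R,
  w = nseq n s ++ R /\ (R = [::] \/ exists R', R = ~~ s :: R').
Proof.
elim: w => [|t w [n [R [-> h]]]]; first by exists 0, [::]; split; [|left].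
case: (t =P s) => [->|ts]; first by exists n.+1, R.
exists 0, (t :: nseq n s ++ R); split=> //; right; exists (nseq n s ++ R).
by congr cons; case: t s ts {h} => -[].
Qed.

Lemma bezout_block c d : 0 < c -> 0 < d -> coprime c d -> exists x0 y0,
  [/\ x0 < d, 0 < y0, y0 <= c & d * y0 = (c * x0).+1].
Proof.
move=> c0 d0; rewrite coprime_sym => /eqP g1.
case: (egcdnP c d0) => y0 x0; rewrite g1 muln1 addn1 => e h.
have y1 : 0 < y0 by case: (y0) e.
exists x0, y0; split=> //; last by lia.
have h1 : d * y0 <= c * d by have := leq_mul (leqnn c) h; rewrite mulnS; lia.
by move: h1; rewrite [c * d]mulnC leq_pmul2l.
Qed.

(** The box with southwest corner [(x, y)] lies southeast of a valley and below
    the main diagonal: membership in the union of the sets [Uhat], for the valley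
    levels. *)
Definition cut_by_valley (a b : nat) (w : seq bool) (x y : nat) : Prop :=
  exists z, [/\ valley w z, z.1 <= x, y < z.2 & (level a b (x, y.+1) <= 0)%R].

Record valley_word (a b k : nat) (Q : seq bool) : Prop := ValleyWord {
  vw_norths : count_mem true Q = a;
  vw_easts : count_mem false Q = b;
  vw_dyck : forall i, i <= size Q -> (0 <= level a b (point Q i))%R;
  vw_valley : forall x y, x <= b -> y <= a ->
    valley Q (x, y) = (1 <= level a b (x, y) <= k%:Z)%R }.

Lemma kth_valley_word a b k (Q : lpath a b) : kth_valley_path k Q -> valley_word a b k Q.
Proof.
case=> /dyckP[hN hE hD] hV; split=> // i iQ; have := hD i iQ.
by rewrite /level; lia.
Qed.

Lemma level0P a b x y : coprime a b -> x <= b -> y <= a -> 0 < x ->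
  level a b (x, y) = 0%R -> x = b /\ y = a.
Proof.
move=> hab xb ya x0; rewrite levelE => h.
have e : b * y = a * x by lia.
have bx : x = b.
  apply/eqP; rewrite eqn_leq xb dvdn_leq // -(@Gauss_dvdr _ a) 1?coprime_sym //.
  by rewrite -e dvdn_mulr.
split=> //; apply/eqP; rewrite -(@eqn_pmul2l b); last by lia.
by rewrite e bx mulnC.
Qed.

(** The points of levels 1 to [k] are valleys, hence lie on the path; but a run of
    norths followed by a run of easts leaves the corner below it untouched.  So
    levels at most [k] are negative in that corner. *)
Lemma block_steep a b k Q U c d R :
  coprime a b -> valley_word a b k Q ->
  Q = U ++ nseq c true ++ nseq d false ++ R ->
  forall x y, count_mem false U < x <= count_mem false U + d ->
    count_mem true U <= y < count_mem true U + c ->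
    (level a b (x, y) <= k%:Z)%R -> (level a b (x, y) < 0)%R.
Proof.
move=> hab [hN hE hD hV] QE x y xU yU lk.
have := hE; have := hN; rewrite {1 2}QE !count_cat !count_run => hN' hE'.
have xb : x <= b by lia.
have ya : y <= a by lia.
rewrite ltNge; apply/negP => l0.
have : level a b (x, y) = 0%R \/ (1 <= level a b (x, y))%R by lia.
case=> [/(level0P hab xb ya)|l1]; first by lia.
have : valley Q (x, y) by rewrite hV // l1 lk.
case/valleyP => i _ [_ _ e]; have := @point_before_run U c (nseq d false ++ R) i.
rewrite -QE -e => h; case/andP: yU => _ /h.
by case/andP: xU; rewrite ltnNge => /negP.
Qed.

(** Between consecutive valleys [p] and [q], the vector [q - p = (d, c)] is
    primitive, and its Bezout vector [(x0, y0)] has a level above that of [q].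
    Otherwise a lattice point strictly inside the segment, or the point
    [q - (x0, y0)] just below it, would have a level between 0 and [k], against
    [block_steep]. *)
Lemma block_bezout a b k Q U c d R (g0 g1 : int) :
  coprime a b -> valley_word a b k Q ->
  Q = U ++ nseq c true ++ nseq d false ++ R ->
  0 < c -> 0 < d ->
  g0 = level a b (count_mem false U, count_mem true U) ->
  g1 = level a b (count_mem false U + d, count_mem true U + c) ->
  (0 <= g0 <= k%:Z)%R -> (0 <= g1 <= k%:Z)%R ->
  exists x0 y0, [/\ x0 < d, y0 <= c, d * y0 = (c * x0).+1
    & (g1 < (b * y0)%:Z - (a * x0)%:Z)%R].
Proof.
move=> hab vw QE c0 d0 eg0 eg1 hg0 hg1.
have b0 : 0 < b.
  by have := vw_easts vw; rewrite QE !count_cat !count_run; lia.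
have NL := block_steep hab vw QE.
(* Otherwise [(d, c)] is [G] times a shorter vector. *)
have cop : coprime c d.
  rewrite /coprime eqn_leq gcdn_gt0 c0 andbT leqNgt; apply/negP => G1.
  have [/dvdnP[c' cE] /dvdnP[d' dE]] := (dvdn_gcdl c d, dvdn_gcdr c d).
  move: (gcdn c d) G1 cE dE => G G1 cE dE.
  have c'0 : 0 < c' by case: (c') cE; lia.
  have d'0 : 0 < d' by case: (d') dE; lia.
  have c'c : c' < c by rewrite cE ltn_Pmulr.
  have d'd : d' < d by rewrite dE ltn_Pmulr.
  (* The level is affine: [G] steps of the segment lead from [g0] to [g1]. *)
  have lE : (G%:Z * level a b (count_mem false U + d', count_mem true U + c')%N
             = (G%:Z - 1) * g0 + g1)%R.
    by rewrite eg0 eg1 !levelE cE dE; lia.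
  have G0 : (0 < G%:Z)%R by lia.
  have h0 : (0 <= G%:Z * level a b (count_mem false U + d', count_mem true U + c')%N)%R.
    rewrite lE; have : (0 <= (G%:Z - 1) * g0)%R by apply: mulr_ge0; lia.
    lia.
  have h1 : (G%:Z * level a b (count_mem false U + d', count_mem true U + c')%N <= G%:Z * k%:Z)%R.
    rewrite lE; have : ((G%:Z - 1) * g0 <= (G%:Z - 1) * k%:Z)%R by apply: ler_wpM2l; lia.
    lia.
  rewrite pmulr_rge0 // in h0; rewrite ler_pM2l // in h1.
  suff: (level a b (count_mem false U + d', count_mem true U + c')%N < 0)%R by lia.
  by apply: NL h1; lia.
have [x0 [y0 [xd y1 yc bez]]] := bezout_block c0 d0 cop.
exists x0, y0; split=> //.
set l : int := (_ - _)%R.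
have lE : level a b (count_mem false U + d - x0, count_mem true U + c - y0) = (g1 - l)%R.
  rewrite eg1 /l !levelE.
  have h1 : b * y0 <= b * c by rewrite leq_mul.
  have h2 : a * x0 <= a * d by rewrite leq_mul // ltnW.
  by rewrite !mulnBr; lia.
(* By the Bezout relation, [(x0, y0)] is [(x0 / d) * (d, c)] plus a vertical
   vector of length [1 / d]. *)
have dl : (d%:Z * l = b%:Z + x0%:Z * (g1 - g0))%R.
  have : (d%:Z * y0%:Z = c%:Z * x0%:Z + 1)%R by lia.
  rewrite eg0 eg1 /l !levelE => h.
  have -> : (b%:Z = b%:Z * (d%:Z * y0%:Z - c%:Z * x0%:Z))%R by rewrite h; ring.
  lia.
have lk : (g1 - l <= k%:Z)%R.
  have : (x0%:Z * g0 <= x0%:Z * k%:Z)%R by apply: ler_wpM2l; lia.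
  have : ((d%:Z - x0%:Z) * g1 <= (d%:Z - x0%:Z) * k%:Z)%R by apply: ler_wpM2l; lia.
  move=> h1 h2; have : (d%:Z * (g1 - l) <= d%:Z * k%:Z)%R by lia.
  by rewrite ler_pM2l //; lia.
suff: (level a b (count_mem false U + d - x0, count_mem true U + c - y0)%N < 0)%R.
  by rewrite lE; lia.
by apply: NL; rewrite ?lE //; lia.
Qed.

(** If [b <= k], the point [(0, 1)], of level [b], would be a valley; but a valley
    is preceded by an east step. *)
Lemma valley_word_ltb a b k Q : 0 < a -> 0 < b -> valley_word a b k Q -> k < b.
Proof.
move=> a0 b0 vw; rewrite ltnNge; apply/negP => bk.
have /valley_x_gt0 : valley Q (0, 1); last by [].
by rewrite (vw_valley vw) // levelE muln1 muln0; lia.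
Qed.

Lemma valley_start a b k Q U V : valley_word a b k Q ->
  Q = U ++ true :: V -> (U = [::] \/ exists U', U = rcons U' false) ->
  (0 <= level a b (count_mem false U, count_mem true U) <= k%:Z)%R.
Proof.
move=> vw QE [->|[U' UE]]; first by rewrite levelE !muln0.
have := valley_at QE UE; rewrite (vw_valley vw).
- by case/andP => h ->; rewrite (le_trans _ h).
- by rewrite -(vw_easts vw) QE count_cat leq_addr.
- by rewrite -(vw_norths vw) QE count_cat leq_addr.
Qed.

Lemma ends_east a b k Q U c : 0 < b -> 0 < c -> valley_word a b k Q ->
  Q <> U ++ nseq c true.
Proof.
move=> b0 c0 vw QE; have hN := vw_norths vw; have hE := vw_easts vw.
rewrite QE !count_cat !count_run in hN hE.
have := vw_dyck vw (_ : size U <= size Q).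
rewrite QE size_cat leq_addr => /(_ isT); rewrite /point take_size_cat // levelE.
have : 0 < b * c by rewrite muln_gt0 b0.
by rewrite -hN -{2}hE; lia.
Qed.

Lemma valley_word_start a b k Q : 0 < a -> 0 < b -> valley_word a b k Q ->
  exists V, Q = true :: V.
Proof.
move=> a0 b0 vw; case: Q vw => [|[] V] vw; last 1 first.
- by have := vw_dyck vw (i := 1) isT; rewrite /point /= take0 levelE muln0 muln1; lia.
- by have := vw_norths vw; rewrite /=; lia.
by exists V.
Qed.

(** Every suffix of [Q] that starts at the origin or at a valley has a ranking
    whose defect is the level of its starting point.  The rows of the list by ends
    are those of the boundary of the union of the sets [Uhat]: in the rows of the
    block that ends at the valley [q], the abscissa is that of [q], plus 1 in the
    highest row, where the box with upper left corner [q] crosses the diagonal and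
    is left out. *)
Lemma valley_ranking a b k Q : coprime a b -> 0 < b -> k < a -> valley_word a b k Q ->
  forall n U V, size V < n -> Q = U ++ true :: V ->
  (U = [::] \/ exists U', U = rcons U' false) ->
  exists V' f p, [/\ ranking a b (level a b (count_mem false U, count_mem true U))
                       (true :: V) (false :: V') f p,
    count_mem true V' = (count_mem true V).+1 &
    forall x y, x < b -> y <= count_mem true V ->
      (count_mem false U + easts_before (false :: V') y <= x)
      <-> cut_by_valley a b Q x (count_mem true U + y)].
Proof.
move=> hab b0 ka vw; have kb : k < b by apply: valley_word_ltb b0 vw; lia.
elim=> [//|n IH] U V sV QE hU.
have [c [R1 [VE hR1]]] := run_split true (true :: V).
have {hR1} [R1' R1E] : exists R', R1 = false :: R'.
  case: hR1 => // R10; move: VE; rewrite R10 cats0 => VE.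
  by case: (@ends_east _ _ _ _ U c b0 _ vw); [case: (c) VE | rewrite -VE].
have c0 : 0 < c by case: (c) VE; rewrite // R1E.
have [d [R [R1E' hR]]] := run_split false R1.
have d0 : 0 < d by case: (d) R1E' hR; rewrite // R1E /= => <- [|[]].
have QE' : Q = U ++ nseq c true ++ nseq d false ++ R by rewrite QE VE R1E'.
pose g0 := level a b (count_mem false U, count_mem true U).
pose g1 := level a b (count_mem false U + d, count_mem true U + c).
have hg0 := valley_start vw QE hU.
have hN := vw_norths vw; have hE := vw_easts vw.
rewrite QE' !count_cat !count_run in hN; rewrite QE' !count_cat !count_run in hE.
have gE : (g1 = g0 + (b * c)%:Z - (a * d)%:Z)%R by rewrite /g1 /g0 !levelE; lia.
have cV : (count_mem true V).+1 = c + count_mem true R.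
  have -> : (count_mem true V).+1 = count_mem true (true :: V) by [].
  by rewrite VE R1E' !count_cat !count_run.
(* Either the block is the last one, or it ends at a valley and the suffix from
   there has a ranking of defect [g1]. *)
case: hR => [R0|[V1 R1V]].
  have nil0 s : count_mem s [::] = 0 by [].
  rewrite R0 !nil0 in cV hN hE.
  have g10 : g1 = 0%R.
    have -> : g1 = level a b (b, a) by rewrite /g1; congr (level _ _ (_, _)); lia.
    by rewrite levelE mulnC subrr.
  have [|x0 [y0 [xd yc bez gl]]] :=
    block_bezout hab vw QE' c0 d0 (erefl g0) (erefl g1) hg0.
    by rewrite g10; lia.
  rewrite g10 in gl gE.
  have [f [p rk]] := ranking_block c0 d0 bez xd yc (proj1 (andP hg0)) gl (esym gE).
  exists (nseq d.-1 false ++ nseq c true), f, p; split.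
  - move: rk; rewrite VE R1E' R0 cats0.
    by case: (d) d0 => // d' _.
  - by rewrite count_cat !count_run cV addn0.
  move=> x y xb yV; split.
    rewrite (_ : false :: _ = nseq d false ++ nseq c true); last by case: (d) d0.
    by rewrite easts_before_cat !count_run ltn0; lia.
  case=> -[zx zy] [vz /= zxx yz _]; move: vz; rewrite QE' R0.
  by move=> vz; have [|] := valley_after_block vz; first exact: leq_ltn_trans (leq_addr _ _) yz.
have cons1 : (count_mem true (true :: V1) = (count_mem true V1).+1)
  * (count_mem false (true :: V1) = count_mem false V1) by [].
rewrite R1V !cons1 in cV hN hE.
have Q1 : Q = (U ++ nseq c true ++ nseq d false) ++ true :: V1.
  by rewrite QE' R1V !catA.
have U1 : (U ++ nseq c true ++ nseq d false) = [::] \/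
   exists U', U ++ nseq c true ++ nseq d false = rcons U' false.
  right; exists (U ++ nseq c true ++ nseq d.-1 false).
  case: (d) d0 => // d' _; rewrite -cats1 -!catA; congr (_ ++ (_ ++ _)).
  by rewrite -addn1 nseqD addn1.
have [] := IH _ V1 _ Q1 U1.
  have := congr1 size VE; rewrite R1E' R1V !size_cat !size_nseq /=; lia.
rewrite !count_cat !count_run !addn0 add0n => V1' [f1 [p1 [rk1 cV1 row1]]].
have hg1 := valley_start vw Q1 U1.
rewrite !count_cat !count_run !addn0 add0n -/g1 in hg1 rk1.
have vz1 : valley Q (count_mem false U + d, count_mem true U + c).
  case: U1 => [U10|[U' /(valley_at Q1)]].
    by have := congr1 size U10; rewrite !size_cat !size_nseq /=; lia.
  by rewrite !count_cat !count_run !addn0 add0n.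
have g11 : (1 <= g1)%R.
  by move: vz1; rewrite (vw_valley vw); [case/andP | lia | lia].
have [x0 [y0 [xd yc bez gl]]] :=
  block_bezout hab vw QE' c0 d0 (erefl g0) (erefl g1) hg0 hg1.
have [|f [p rk]] := ranking_glue c0 d0 bez xd yc (proj1 (andP hg0)) _ gl gE rk1.
  by lia.
pose W' := nseq d.-1 false ++ nseq c.-1 true ++ [:: false, true & V1'].
have W'E : nseq d false ++ nseq c.-1 true ++ [:: false, true & V1'] = false :: W'.
  by rewrite /W'; case: (d) d0.
exists W', f, p; split.
- by rewrite VE R1E' R1V -W'E.
- have cons2 : count_mem true [:: false, true & V1'] = (count_mem true V1').+1 by [].
  by rewrite /W' !count_cat !count_run cons2 cV1 cV; lia.
move=> x y xb yV; rewrite -W'E !easts_before_cat !count_run ltn0 subn0.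
(* Rows of the block, up to [q] at its upper end; the rows above are those of the
   suffix. *)
case: (ltnP y c) => yc'.
  have -> : (if y < c.-1 then easts_before (nseq c.-1 true) y
     else 0 + easts_before [:: false, true & V1'] (y - c.-1)) = (y == c.-1).
    case: ltnP => yc1; last by rewrite (_ : y = c.-1) ?subnn ?eqxx //; lia.
    apply/eqP; rewrite (_ : (y == c.-1) = false); last by lia.
    rewrite -leqn0; apply: leq_trans (easts_before_le _ _) _.
    by rewrite count_run.
  have pE : g1 = level a b (count_mem false U + d, count_mem true U + c) by [].
  rewrite levelE in pE; split.
    move=> h; exists (count_mem false U + d, count_mem true U + c); split=> //.
    - by rewrite [X in X <= _]/fst; lia.
    - by rewrite [X in _ < X]/snd; lia.
    (* Off the corner, the level drops by [a] or [b], hence by more than [k]. *)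
    have [i xE] : exists i, x = count_mem false U + d + i.
      by exists (x - (count_mem false U + d)); lia.
    have [j yE] : exists j, c = y.+1 + j by exists (c - y.+1); lia.
    case/andP: hg1 => _; rewrite pE levelE xE yE => hg1k.
    case: i xE => [|i] xE.
      have : b <= b * j by rewrite leq_pmulr //; lia.
      by lia.
    have : a <= a * i.+1 by rewrite leq_pmulr.
    by lia.
  case=> -[zx zy] [vz zxx yz lz]; have {}zxx : zx <= x := zxx.
  have {}yz : count_mem true U + y < zy := yz.
  move: (vz); rewrite QE' => /valley_after_block[|_ hzx hzy].
    exact: leq_ltn_trans (leq_addr _ _) yz.
  case: (y =P c.-1) => yc1; last by rewrite addn0; lia.
  rewrite leqNgt; apply/negP => xd'.
  have xE : x = count_mem false U + d by lia.
  move: lz; rewrite levelE xE (_ : (count_mem true U + y).+1 = count_mem true U + c); last by lia.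
  by lia.
rewrite ifN; last by lia.
have -> : 0 + easts_before [:: false, true & V1'] (y - c.-1)
    = easts_before (false :: V1') (y - c).
  by rewrite (_ : y - c.-1 = (y - c).+1) //; lia.
have := row1 x (y - c) xb; rewrite -addnA -[_ + c + _]addnA subnKC // addnA; apply.
by lia.
Qed.

(** * Boxes and the conjugate-area map *)

Lemma mem_bigcup_nat (T : finType) (F : nat -> {set T}) m n c :
  (c \in \bigcup_(m <= l < n) F l) = has (fun l => c \in F l) (index_iota m n).
Proof.
rewrite (big_morph (fun A : {set T} => c \in A) (id1 := false) (op1 := orb)) ?big_has //.
  by move=> A B; rewrite in_setU.
by rewrite in_set0.
Qed.

(** The sets [Vhat] dissect the union of the sets [Uhat]: a box of the union is
    kept by the first [Uhat] that contains it. *)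
Lemma mem_bigcup_Vhat a b k (c : box a b) : reflect
  (exists2 l, 0 < l <= k & c \in Uhat a b l) (c \in \bigcup_(1 <= l < k.+1) Vhat a b l).
Proof.
rewrite mem_bigcup_nat; apply: (iffP hasP) => [[l]|[l lk cl]].
  by rewrite mem_index_iota ltnS inE => lk /andP[_ cl]; exists l.
have ex : exists l, (0 < l) && (c \in Uhat a b l) by exists l; case/andP: lk => ->.
case: (ex_minnP ex) => m /andP[m0 cm] minm; exists m.
  rewrite mem_index_iota m0 ltnS; case/andP: lk => l0 lk.
  by apply: leq_trans (minm l _) lk; rewrite l0.
rewrite inE cm andbT mem_bigcup_nat; apply/hasPn => i; rewrite mem_index_iota => /andP[i0 im].
by apply: contraTN im => ci; rewrite -leqNgt minm // i0.
Qed.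

Lemma Vhat_disjoint a b l m : 0 < l -> 0 < m -> l != m ->
  [disjoint Vhat a b l & Vhat a b m].
Proof.
wlog lm : l m / l < m => [hw l0 m0 lm|l0 m0 _].
  case: (ltngtP l m) lm => // h _; first by apply: hw => //; lia.
  by rewrite disjoint_sym; apply: hw => //; lia.
rewrite disjoint_subset; apply/subsetP => c; rewrite inE => /andP[_ cl].
rewrite !inE negb_and negbK mem_bigcup_nat; apply/orP; left.
by apply/hasP; exists l; rewrite ?mem_index_iota ?l0.
Qed.

Lemma mem_UhatP a b k (Q : seq bool) (c : box a b) : valley_word a b k Q ->
  (exists2 l, 0 < l <= k & c \in Uhat a b l) <-> cut_by_valley a b Q (val c.1) (val c.2).
Proof.
move=> vw; split=> [[l lk]|[[x y] [vz xc yc lc]]].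
  rewrite !inE => /andP[/existsP[[x y]] /and3P[/eqP lz xc yc] lc].
  exists (val x, val y); split=> //.
  by rewrite (vw_valley vw) ?leq_ord // lz; lia.
have xb : x <= b by apply: ltnW; apply: leq_ltn_trans xc (ltn_ord _).
have ya : y <= a.
  case/valleyP: vz => i _ [_ _ [_ ->]]; rewrite -(vw_norths vw) -{2}(cat_take_drop i Q).
  by rewrite count_cat leq_addr.
move: vz; rewrite (vw_valley vw) // => lz.
exists (absz (level a b (x, y))); first by lia.
rewrite !inE lc andbT; apply/existsP; exists (inord x, inord y); rewrite /= !inordK ?ltnS //.
by rewrite xc yc !andbT; apply/eqP; lia.
Qed.

Lemma count_ltn_iota m n : m <= n -> count (fun x => x < m) (iota 0 n) = m.
Proof.
move=> mn; rewrite -{1}(subnKC mn) iotaD count_cat -[RHS]addn0; congr (_ + _).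
  rewrite -[RHS](size_iota 0 m); apply/eqP; rewrite -all_count.
  by apply/allP => x; rewrite mem_iota add0n.
apply/eqP; rewrite -leqn0 leqNgt -has_count; apply/hasPn => x.
by rewrite mem_iota -leqNgt => /andP[].
Qed.

Lemma rotated_diagramE a b (w : seq bool) (c : box a b) :
  count_mem true w = a -> count_mem false w = b ->
  (c \in rotated_diagram a b (bounded_partition a b (rev w)))
    = (easts_before w c.2 <= c.1).
Proof.
move=> cN cE; case: c => x y /=; have ya := ltn_ord y; have xb := ltn_ord x.
rewrite inE /= (nth_map 0) ?size_iota // nth_iota // add0n.
rewrite (eq_count (a2 := fun z => z < easts_before (rev w) (a - y.+1))); last first.
  by move=> z; rewrite aboveE.
have yw : y < count_mem true w by rewrite cN.
have := easts_before_rev yw; rewrite cN cE => e.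
rewrite count_ltn_iota; last by rewrite -e leq_addr.
by move: (easts_before (rev w) _) (easts_before w _) e (nat_of_ord x) xb => E1 E2 e z zb; lia.
Qed.

Theorem proposition8p5 (a b : nat) (ha : 0 < a) (hb : 0 < b)
    (hab : coprime a b)
    (hzeta : forall c d : nat, 0 < c -> c <= a -> 0 < d -> d <= b ->
       coprime c d -> zeta_bijective c d)
    (k : nat) (hk : k < a) (Q : lpath a b) (hQ : kth_valley_path k Q) :
  rotated_diagram a b (bounded_partition a b (chi Q))
    = \bigcup_(1 <= l < k.+1) Vhat a b l
  /\ (forall l m : nat, 0 < l <= k -> 0 < m <= k -> l != m ->
        [disjoint Vhat a b l & Vhat a b m]).
Proof.
split; last by move=> l m /andP[l0 _] /andP[m0 _]; apply: Vhat_disjoint.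
have vw := kth_valley_word hQ.
have [V QE] := valley_word_start ha hb vw.
have QU : tval Q = [::] ++ true :: V by [].
have [V' [f [p [rk cV' row]]]] :=
  valley_ranking hab hb hk vw (ltnSn (size V)) QU (or_introl erefl).
have l0 : level a b (count_mem false [::], count_mem true [::]) = 0%R by rewrite levelE !muln0.
rewrite l0 -QE in rk.
have cN := vw_norths vw; have cE := vw_easts vw.
have zP : zeta (orbit_path a b Q p) = Q.
  by apply: val_inj; apply: orbit_zeta rk.
have [_ zinj _] := hzeta a b ha (leqnn a) hb (leqnn b) hab.
have PD : orbit_path a b Q p \in dyck a b by apply: orbit_dyck rk.
have zi : zeta_inv Q = orbit_path a b Q p.
  rewrite /zeta_inv; case: pickP => [P /andP[PD' /eqP zP']|/(_ (orbit_path a b Q p))].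
    by apply: zinj => //; rewrite zP zP'.
  by rewrite PD zP eqxx.
have chiE : chi Q = rev (false :: V') :> seq bool.
  by rewrite /chi zi; apply: orbit_conjugate_zeta rk.
have cN' : count_mem true (false :: V') = a.
  by rewrite /= add0n cV' -cN QE.
have cE' : count_mem false (false :: V') = b.
  have := ranking_size rk; rewrite size_word cN' (size_word Q) cN cE; lia.
apply/setP => c; rewrite chiE rotated_diagramE //.
have yV : c.2 <= count_mem true V.
  by rewrite -ltnS (_ : (count_mem true V).+1 = a) // -cN QE.
have := row c.1 c.2 (ltn_ord _) yV; rewrite !add0n => rowc.
by apply/idP/mem_bigcup_Vhat => [/rowc/(mem_UhatP c vw)|/(mem_UhatP c vw)/rowc].
Qed.
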